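(* There exist constants $C$ and $m_0$ such that for all integers $n,m\geq m_0$ with $\frac{n}{2}\leq m< n$, $$2n+2m-2\leq R(C_{2m}, F_n)\leq R(C_{2m}, W_{2n})\leq 2n+2m+C.$$
   Context: $C_\ell$ denotes the cycle of length $\ell$. For $k\ge 3$, the wheel $W_k$ is the graph on $k+1$ vertices obtained by joining one vertex to every vertex of a cycle of length $k$. The fan $F_n$ is the graph on $2n+1$ vertices obtained by joining one vertex to every vertex of a matching with $n$ edges. For graphs $H_1,H_2$, the Ramsey number $R(H_1,H_2)$ is the smallest integer $N$ such that in every coloring of the edges of $K_N$ with colors 1 and 2 there is a copy of $H_1$ in color 1 or a copy of $H_2$ in color 2. *)

(* Defs.v *)
From HB Require Import structures.
From mathcomp Require Import all_boot.

Set Implicit Arguments.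
Unset Strict Implicit.
Unset Printing Implicit Defensive.

Record sgraph := SGraph {
  vertex :> finType;
  edge : rel vertex;
  edge_sym : symmetric edge;
  edge_irrefl : irreflexive edge }.

(* [contains G H]: G has a (not necessarily induced) subgraph isomorphic to H. *)
Definition contains (G H : sgraph) : bool :=
  [exists f : {ffun H -> G},
    injectiveb f && [forall x, forall y, edge x y ==> edge (f x) (f y)]].

Section Cycle.
Variable l : nat.

Definition cycle_edge (i j : 'I_l) : bool :=
  (i != j) && ((i.+1 == j %[mod l]) || (j.+1 == i %[mod l])).

Lemma cycle_edge_sym : symmetric cycle_edge.
Proof. by move=> i j; rewrite /cycle_edge eq_sym orbC. Qed.

Lemma cycle_edge_irrefl : irreflexive cycle_edge.
Proof. by move=> i; rewrite /cycle_edge eqxx. Qed.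

(* This is the cycle of length l when 3 <= l. *)
Definition cycle_graph : sgraph := SGraph cycle_edge_sym cycle_edge_irrefl.

End Cycle.

Section Matching.
Variable n : nat.

Definition matching_edge (u v : 'I_n * bool) : bool :=
  (u.1 == v.1) && (u.2 != v.2).

Lemma matching_edge_sym : symmetric matching_edge.
Proof.
by move=> u v; rewrite /matching_edge eq_sym [u.2 == _]eq_sym.
Qed.

Lemma matching_edge_irrefl : irreflexive matching_edge.
Proof. by move=> u; rewrite /matching_edge !eqxx. Qed.

Definition matching_graph : sgraph :=
  SGraph matching_edge_sym matching_edge_irrefl.

End Matching.

Section Cone.
Variable G : sgraph.

(* [None] is the new vertex, joined to every vertex of G. *)
Definition cone_edge (u v : option G) : bool :=
  match u, v with
  | None, None => false
  | Some x, Some y => edge x y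
  | _, _ => true
  end.

Lemma cone_edge_sym : symmetric cone_edge.
Proof. by case=> [x|] [y|] //=; rewrite edge_sym. Qed.

Lemma cone_edge_irrefl : irreflexive cone_edge.
Proof. by case=> [x|] //=; rewrite edge_irrefl. Qed.

Definition cone_graph : sgraph := SGraph cone_edge_sym cone_edge_irrefl.

End Cone.

Definition wheel_graph (k : nat) : sgraph := cone_graph (cycle_graph k).

Definition fan_graph (n : nat) : sgraph := cone_graph (matching_graph n).

(* A 2-colouring of the edges of K_N.  Edges are two-element sets of vertices,
   so the values at sets of any other size are irrelevant.  Colour 1 is [true]
   and colour 2 is [false]. *)
Definition coloring (N : nat) := {ffun {set 'I_N} -> bool}.

Section ColorClass.
Variables (N : nat) (c : coloring N) (i : bool).

Definition color_edge (x y : 'I_N) : bool := (x != y) && (c [set x; y] == i).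

Lemma color_edge_sym : symmetric color_edge.
Proof. by move=> x y; rewrite /color_edge eq_sym setUC. Qed.

Lemma color_edge_irrefl : irreflexive color_edge.
Proof. by move=> x; rewrite /color_edge eqxx. Qed.

Definition color_class : sgraph := SGraph color_edge_sym color_edge_irrefl.

End ColorClass.

Definition ramsey_arrow (H1 H2 : sgraph) (N : nat) : bool :=
  [forall c : coloring N,
    contains (color_class c true) H1 || contains (color_class c false) H2].

Lemma ramsey_clique (a b : nat) :
  exists N, forall (T : finType) (c : {set T} -> bool) (A : {set T}),
    N <= #|A| ->
    exists S : {set T}, exists i : bool,
      (if i then a else b) <= #|S| /\ S \subset A /\
      forall x y, x \in S -> y \in S -> x != y -> c [set x; y] = i.
Proof.
elim: a b => [|a IHa] b.
  exists 0 => T c A _; exists set0, true; split=> //; split; first exact: sub0set.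
  by move=> x y; rewrite inE.
elim: b => [|b [Nb HNb]].
  exists 0 => T c A _; exists set0, false; split=> //; split; first exact: sub0set.
  by move=> x y; rewrite inE.
have [Na HNa] := IHa b.+1.
exists (Na + Nb).+1 => T c A leNA.
have /card_gt0P[v Av] : 0 < #|A| by apply: leq_trans leNA.
pose B i := [set y in A :\ v | c [set v; y] == i].
have cardB : #|A :\ v| = #|B true| + #|B false|.
  rewrite -(cardsID (B true) (A :\ v)); congr (_ + _); apply: eq_card => y;
    rewrite !inE; case: (y != v) (y \in A) (c _) => [] [] [] //.
have leNB : Na + Nb <= #|B true| + #|B false|.
  by rewrite -cardB; move: leNA; rewrite (cardsD1 v A) Av.
have subB i : B i \subset A.
  by apply/subsetP=> y; rewrite !inE => /andP[/andP[]].
have ext i (S : {set T}) : S \subset B i ->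
    (forall x y, x \in S -> y \in S -> x != y -> c [set x; y] = i) ->
  [/\ #|v |: S| = #|S|.+1, v |: S \subset A &
    forall x y, x \in v |: S -> y \in v |: S -> x != y -> c [set x; y] = i].
  move=> sSB cS; split.
  - rewrite cardsU1; case vS: (v \in S) => //.
    by have := subsetP sSB _ vS; rewrite !inE eqxx.
  - by rewrite subUset sub1set Av (subset_trans sSB).
  have cv y : y \in S -> c [set v; y] = i.
    by move/(subsetP sSB); rewrite !inE => /andP[_ /eqP].
  move=> x y; rewrite !inE => /orP[/eqP-> | xS] /orP[/eqP-> | yS].
  - by rewrite eqxx.
  - by move=> _; exact: cv.
  - by move=> _; rewrite setUC; exact: cv.
  exact: cS.
have [leNa | ltNa] := leqP Na #|B true|.
  have [S [[] [cardS [sSB cS]]]] := HNa T c _ leNa.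
    have [cvS svS cvS'] := ext true S sSB cS.
    by exists (v |: S), true; rewrite cvS.
  by exists S, false; split=> //; split=> //; apply: subset_trans (subB true).
have leNb : Nb <= #|B false|.
  rewrite -(leq_add2l #|B true|); apply: leq_trans leNB.
  by rewrite leq_add2r ltnW.
have [S [[] [cardS [sSB cS]]]] := HNb T c _ leNb.
  by exists S, true; split=> //; split=> //; apply: subset_trans (subB false).
have [cvS svS cvS'] := ext false S sSB cS.
by exists (v |: S), false; rewrite cvS.
Qed.

Lemma contains_clique (G H : sgraph) (S : {set G}) :
  #|H| <= #|S| ->
  (forall x y, x \in S -> y \in S -> x != y -> edge x y) ->
  contains G H.
Proof.
move=> leHS cS.
pose f (x : H) : G := enum_val (widen_ord leHS (enum_rank x)).
have inj_f : injective f.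
  by move=> x y /enum_val_inj/(congr1 val)/= /val_inj/enum_rank_inj.
apply/existsP; exists [ffun x => f x]; apply/andP; split.
  by apply/injectiveP => x y; rewrite !ffunE => /inj_f.
apply/forallP=> x; apply/forallP=> y; apply/implyP=> exy; rewrite !ffunE.
apply: cS; try exact: enum_valP.
by apply: contraTneq exy => /inj_f->; rewrite edge_irrefl.
Qed.

Lemma ramsey_arrow_exists (H1 H2 : sgraph) : exists N, ramsey_arrow H1 H2 N.
Proof.
have [N HN] := ramsey_clique #|H1| #|H2|.
exists N; apply/forallP=> c.
have [|S [i [cardS [_ cS]]]] := HN _ c [set: 'I_N].
  by rewrite cardsT card_ord.
apply/orP; case: i cardS cS => cardS cS; [left | right].
  apply: (@contains_clique (color_class c true) _ S) => // x y xS yS nxy.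
  by rewrite /= /color_edge nxy cS.
apply: (@contains_clique (color_class c false) _ S) => // x y xS yS nxy.
by rewrite /= /color_edge nxy cS.
Qed.

(* The least N such that [ramsey_arrow H1 H2 N]. *)
Definition ramsey (H1 H2 : sgraph) : nat :=
  ex_minn (ramsey_arrow_exists H1 H2).

(* Main.v *)
Require Import Defs.
From mathcomp Require Import all_boot zify.

(** The lower bound comes from a disjoint union of colour-1 cliques of sizes 2m-1, n-1, n-1.

    For the upper bound suppose that there is neither a C_2m in colour 1 nor a W_2n in
    colour 2.  Extending cycles two vertices at a time shows R(C_2m, C_2n) <= 2n + m + O(1),
    so every vertex has colour-2 degree less than 2n + m + O(1), hence colour-1 degree at
    least m + c with c as large as we like.  Cutting the colour-1 graph G along at most two
    vertices at a time leaves, after the removal of a bounded set, 3-connected pieces of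
    minimum degree greater than h = m + O(1).  A longest cycle in a piece with at least 2h
    vertices yields an even cycle of length at least 2h: an outside vertex is excluded by
    counting the gaps between attachments of a long detour, and a Hamiltonian odd cycle has
    too many chords to avoid two crossing ones that close an even cycle.  In a graph of linear
    minimum degree a long even cycle can be shortened to any prescribed even length that is
    smaller by at least a constant, so G would contain C_2m.  Hence all pieces have
    fewer than 2h vertices; the colour-2 graph then contains a complete multipartite graph, and
    Dirac's theorem gives a C_2n in the colour-2 neighbourhood of a vertex of a smallest piece. *)

Set Implicit Arguments.
Unset Strict Implicit.
Unset Printing Implicit Defensive.

(* Sizes are generalized because lia treats [size] terms whose carriers are merely
   convertible as different atoms. *)
Ltac nlia :=
  repeat match goal with
  | H : ?P |- _ =>
    lazymatch P with
    | is_true (leq _ _) => fail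
    | @eq nat _ _ => fail
    | nat => fail
    | _ => clear H
    end
  end;
  repeat match goal with
  | H : is_true (leq _ _) |- _ => revert H
  | H : @eq nat _ _ |- _ => revert H
  end;
  repeat match goal with
  | |- context [@size _ ?p] => move: (size p) => ?
  end; lia.

(** The main obstacle is parity: colour 1 has to yield the exact even length 2m, so every detour,
    shortcut and chord is controlled modulo 2. Pieces with fewer than 2h vertices cannot be
    excluded, since a clique on 2m - 1 vertices has no C_2m, and the lower bound consists of such
    pieces; what they give instead is that all edges between different pieces have colour 2.
    Three-connectivity is the right condition on a piece because a detour must still reach the cycle
    away from a chosen attachment after one more vertex has been deleted. The degree excess c is
    spent twice: each level of cutting costs two, and the shortening needs a bounded gap between 2h
    and 2m. The assumption n <= 2m bounds the number of vertices by 7m, so that degree m is linear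
    in it. In the lower bound it keeps the cliques on n - 1 vertices below length 2m; a fan there
    fails because each of its n matching edges would join the two parts avoiding the centre, and one
    of these has fewer than n vertices. *)

Definition has_cycle (T : finType) (e : rel T) (X : {set T}) (k : nat) : Prop :=
  exists s : seq T, [/\ cycle e s, uniq s, size s = k & {subset s <= X}].

Lemma has_cycleS (T : finType) (e : rel T) (X Y : {set T}) k :
  X \subset Y -> has_cycle e X k -> has_cycle e Y k.
Proof.
move=> sXY [s [cs us ks sX]]; exists s; split=> // x /sX; exact: subsetP.
Qed.

Lemma last_take (T : Type) (d x : T) s a : a <= size s -> last x (take a s) = nth d (x :: s) a.
Proof. by elim: s x a => [|z s IH] x [|a] //= lea; apply: IH. Qed.

(** * Cycles assembled from blocks, and insertion into a cycle *)

Section Paths.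
Variables (T : finType) (e : rel T).

Definition block_seq (b : T * seq T) : seq T := b.1 :: b.2.
Definition block_end (b : T * seq T) : T := last b.1 b.2.

(** [F] collects the connectors used so far. Together with the blocks still to be linked they number
    at most [p], so each step finds a common neighbour outside [F]. *)
Lemma greedy_path (U : {set T}) (p : nat) (bs : seq (T * seq T)) b (F : {set T}) :
  (forall c, c \in b :: bs -> path e c.1 c.2) ->
  (forall c d, c \in b :: bs -> d \in b :: bs ->
     p <= #|[set u in U | e (block_end c) u && e u d.1]|) ->
  #|F| + size bs <= p ->
  exists s us, [/\ path e b.1 (b.2 ++ s),
    last b.1 (b.2 ++ s) = block_end (last b bs),
    perm_eq s (us ++ flatten (map block_seq bs)), uniq us /\ size us = size bs &
    {subset us <= U :\: F}].
Proof.
elim: bs b F => [|c bs IH] b F pb cb leF.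
  exists [::], [::]; rewrite cats0; split=> //.
  by apply: pb; rewrite mem_head.
pose A := [set u in U | e (block_end b) u && e u c.1].
have /card_gt0P[u] : 0 < #|A :\: F|.
  have := cb b c; rewrite mem_head !inE eqxx orbT => /(_ isT isT) leA.
  have := cardsID F A; have := subset_leq_card (subsetIr A F).
  rewrite -/A in leA; rewrite /= in leF; nlia.
rewrite !inE => /and3P[uF uU /andP[ebu euc]].
have [||| s [us [ps ls pms [uus sus] subus]]] := IH c (u |: F).
- by move=> d d_in; apply: pb; rewrite inE d_in orbT.
- by move=> d d' d_in d'_in; apply: cb; rewrite inE ?d_in ?d'_in orbT.
- by rewrite cardsU1 uF; move: leF => /=; nlia.
exists (u :: c.1 :: c.2 ++ s), (u :: us); split => //=.
- by rewrite cat_path /= ebu euc ps pb ?mem_head.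
- by rewrite last_cat /= ls.
- rewrite perm_cons /=.
  rewrite perm_sym (perm_catCA us (c.1 :: c.2)) /= perm_cons perm_cat2l.
  by rewrite perm_sym.
- split; last by rewrite sus.
  by rewrite uus andbT; apply/negP => /subus; rewrite !inE eqxx.
- move=> x; rewrite inE => /predU1P[->|/subus]; first by rewrite !inE uF.
  by rewrite !inE negb_or => /andP[/andP[_ ->]].
Qed.

(* The blocks are linked one after the other through fresh common neighbours in U. *)
Lemma greedy_cycle (U : {set T}) (p : nat) (bs : seq (T * seq T)) :
  0 < size bs -> size bs <= p ->
  (forall c, c \in bs -> path e c.1 c.2) ->
  (forall c d, c \in bs -> d \in bs ->
     p <= #|[set u in U | e (block_end c) u && e u d.1]|) ->
  uniq (flatten (map block_seq bs)) ->
  (forall x, x \in flatten (map block_seq bs) -> x \notin U) ->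
  exists s us, [/\ cycle e s, uniq s, perm_eq s (us ++ flatten (map block_seq bs)),
    size us = size bs & {subset us <= U}].
Proof.
case: bs => [//|b bs] _ lep pb cb ubs dU.
have [|s [us [ps ls pms [uus sus] subus]]] := @greedy_path U p bs b set0 pb cb.
  by rewrite cards0; move: lep => /=; nlia.
pose A := [set u in U | e (block_end (last b bs)) u && e u b.1].
have /card_gt0P[u] : 0 < #|A :\: [set x in us]|.
  have := cb (last b bs) b; rewrite mem_last mem_head => /(_ isT isT) leA.
  have := cardsID [set x in us] A.
  have := subset_leq_card (subsetIr A [set x in us]).
  have : #|[set x in us]| = size us by rewrite cardsE; apply/card_uniqP.
  rewrite -/A in leA; move: lep => /=; nlia.
rewrite !inE => /and3P[uus' uU /andP[ebu euc]].
have pm : perm_eq (u :: b.1 :: b.2 ++ s) ((u :: us) ++ flatten (map block_seq (b :: bs))).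
  rewrite /= perm_cons perm_sym (perm_catCA us (b.1 :: b.2)) /= perm_cons perm_cat2l.
  by rewrite perm_sym.
have subU : {subset u :: us <= U}.
  by move=> x; rewrite inE => /predU1P[->//|/subus]; rewrite !inE.
exists (u :: b.1 :: b.2 ++ s), (u :: us); split => //.
- by rewrite /= euc rcons_path ps ls ebu.
- have uu : uniq (u :: us) by rewrite /= uus' uus.
  rewrite (perm_uniq pm) cat_uniq uu ubs andbT.
  by apply/hasPn => x /dU; apply: contra => /subU.
- by rewrite /= sus.
Qed.

Lemma size_block1 (s : seq T) :
  flatten (map block_seq (map (fun x => (x, [::])) s)) = s.
Proof. by elim: s => //= x s ->. Qed.

Lemma greedy_bipartite (U : {set T}) (ys : seq T) :
  0 < size ys -> uniq ys -> (forall y, y \in ys -> y \notin U) ->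
  (forall y z, y \in ys -> z \in ys ->
     size ys <= #|[set u in U | e y u && e u z]|) ->
  exists s, [/\ cycle e s, uniq s, size s = 2 * size ys &
    forall x, x \in s -> (x \in U) || (x \in ys)].
Proof.
move=> s0 uys dU cU.
have [|||||| s [us [cs us' pm sus subU]]] :=
  @greedy_cycle U (size ys) (map (fun x => (x, [::])) ys).
- by rewrite size_map.
- by rewrite size_map.
- by move=> c /mapP[x _ ->].
- by move=> c d /mapP[x xs ->] /mapP[y ysy ->]; apply: cU.
- by rewrite size_block1.
- by move=> x; rewrite size_block1; apply: dU.
rewrite size_block1 size_map in pm sus.
exists s; split => //.
  by rewrite (perm_size pm) size_cat sus mul2n addnn.
move=> x; rewrite (perm_mem pm) mem_cat => /orP[/subU ->//|->].
by rewrite orbT.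
Qed.

Hypothesis e_sym : symmetric e.

Lemma path_rev_cat y a s t :
  path e y (rev (a :: s) ++ t) = [&& e y (last a s), path e a s & path e a t].
Proof.
rewrite lastI rev_rcons /= cat_path rev_path.
have -> : path (fun z : T => e^~ z) a s = path e a s by apply: eq_path => u v; rewrite e_sym.
congr [&& _, _ & path e _ t].
by case: s => //= x s; rewrite rev_cons last_rcons.
Qed.

(* Both new vertices are inserted by reversing one of the two arcs. *)
Lemma cycle_insert2 (Q : seq T) y y' q1 q2 :
  cycle e Q -> uniq Q -> y != y' -> y \notin Q -> y' \notin Q ->
  q1 \in Q -> q2 \in Q -> q1 != q2 ->
  e y q1 -> e y q2 -> e y' (next Q q1) -> e y' (next Q q2) ->
  exists s, [/\ cycle e s, uniq s & perm_eq s (y :: y' :: Q)].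
Proof.
move=> cQ uQ nyy' yQ y'Q q1Q q2Q nq ey1 ey2 ey'1 ey'2.
have [i p1 p2 _ _ def] := rot_to_arc uQ q1Q q2Q nq.
have uR : uniq (rot i Q) by rewrite rot_uniq.
have cR : cycle e (rot i Q) by rewrite rot_cycle.
rewrite -(next_rot i uQ) def in ey'1; rewrite -(next_rot i uQ) def in ey'2.
have pmQ : perm_eq Q (q1 :: p1 ++ q2 :: p2) by rewrite -def perm_sym perm_rot.
rewrite def in uR cR.
(* [s1] leads from the successor of [q1] to [q2], and [s2] from the successor of [q2] back to [q1].
   The new cycle is y, [s1] reversed, y', [s2]. *)
pose s1 := rcons p1 q2; pose s2 := rcons p2 q1.
have defQ : perm_eq Q (s1 ++ s2).
  by rewrite (perm_trans pmQ) // -[q1 :: _]cat1s perm_catC -catA cat_rcons cats1.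
have [a [s1' def1]] : exists a s1', s1 = a :: s1' by rewrite /s1; case: (p1) => [|a l]; do 2!eexists.
have [b [s2' def2]] : exists b s2', s2 = b :: s2' by rewrite /s2; case: (p2) => [|b l]; do 2!eexists.
have l1 : last a s1' = q2 by rewrite -[last a s1']/(last a (a :: s1')) -def1 last_rcons.
have l2 : last b s2' = q1 by rewrite -[last b s2']/(last a (b :: s2')) -def2 last_rcons.
have na : next (q1 :: p1 ++ q2 :: p2) q1 = a.
  by move: def1; rewrite /s1; case: (p1) => [|c l] /= [<-]; rewrite ?eqxx.
have nb : next (q1 :: p1 ++ q2 :: p2) q2 = b.
  have q2p1 : q2 \notin p1.
    move: uR; rewrite /= cat_uniq /= negb_or => /andP[_ /and3P[_ /andP[]]] //.
  have n21 : (q2 == q1) = false by rewrite eq_sym; apply/negbTE.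
  rewrite /= ; move: def2; rewrite /s2.
  have : forall y1, next_at q2 q1 y1 (p1 ++ q2 :: p2) = head q1 p2 \/ q2 == y1.
    elim: (p1) q2p1 => [|c l IHl] /=.
      move=> _ y1; case: eqP => _; [by right|left].
      by case: (p2) => [|d l] /=; rewrite eqxx.
    rewrite inE negb_or => /andP[/negbTE nc nl] y1; case: eqP => _; [by right|left].
    by case: (IHl nl c) => //; rewrite nc.
  move=> /(_ q1); rewrite n21 => -[-> | //].
  by case: (p2) => [|d l] /= [<-].
rewrite na in ey'1; rewrite nb in ey'2.
have ps12 : path e a (s1' ++ s2) && e q1 a.
  have := cR; rewrite -(rot_cycle 1) rot1_cons.
  rewrite rcons_cat rcons_cons -cat_rcons -/s1 -/s2 def1 /= rcons_path => /andP[-> /=].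
  by rewrite last_cat def2 /= l2.
move: ps12; rewrite cat_path def2 /= => /andP[/and3P[pa _ pb] _].
have pmn : perm_eq (y :: rev s1 ++ y' :: s2) (y :: y' :: Q).
  rewrite perm_cons -[y' :: s2]/([:: y'] ++ s2) perm_catCA /= perm_cons.
  by rewrite perm_sym (perm_trans defQ) // perm_cat2r perm_sym perm_rev.
exists (y :: rev s1 ++ y' :: s2); split => //.
  rewrite def1 def2 /= rcons_cat path_rev_cat l1 ey2 pa /= e_sym ey'1 ey'2 /=.
  by rewrite rcons_path pb l2 e_sym ey1.
by rewrite (perm_uniq pmn) /= inE negb_or nyy' yQ y'Q uQ.
Qed.

End Paths.

(** * Extending a cycle by two vertices *)

Lemma has_cycleP (T : finType) (e : rel T) (X : {set T}) (k : nat) :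
  reflect (has_cycle e X k)
    [exists t : k.-tuple T, [&& cycle e t, uniq t & [set x in t] \subset X]].
Proof.
apply: (iffP existsP) => [[t /and3P[ct ut /subsetP st]] | [s [cs us sk ss]]].
  exists t; split => //; first by rewrite size_tuple.
  by move=> x xt; apply: st; rewrite inE.
have st : size s == k by apply/eqP.
exists (Tuple st); rewrite /= cs us /=; apply/subsetP => x.
by rewrite inE => /ss.
Qed.

Lemma take_enum (T : finType) (A : {set T}) k : k <= #|A| ->
  exists s : seq T, [/\ uniq s, size s = k & {subset s <= A}].
Proof.
move=> leA; exists (take k (enum A)); split.
- by rewrite take_uniq ?enum_uniq.
- by rewrite size_takel // -cardE.
- by move=> x /mem_take; rewrite mem_enum.
Qed.

Lemma clique_path (T : finType) (e : rel T) (K : {set T}) x s :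
  (forall u v, u \in K -> v \in K -> u != v -> e u v) ->
  uniq (x :: s) -> {subset x :: s <= K} -> path e x s.
Proof.
move=> cK; elim: s x => //= y s IH x /and3P[]; rewrite inE negb_or => /andP[nxy _] ys us sub.
rewrite cK ?sub ?inE ?eqxx ?orbT //=; apply: IH; first by rewrite /= ys.
by move=> z zs; apply: sub; rewrite inE zs orbT.
Qed.

(** Disjoint edges are removed greedily; if this stops early, the rest is independent. The edges are
    recorded as blocks so that [greedy_cycle] can use them directly. *)
Lemma matching_or_independent (T : finType) (B : rel T) (j : nat) (Z : {set T}) :
  (exists bs : seq (T * seq T), [/\ size bs = j,
     forall c, c \in bs -> path B c.1 c.2,
     size (flatten (map (@block_seq T) bs)) = 2 * j,
     uniq (flatten (map (@block_seq T) bs)) &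
     {subset flatten (map (@block_seq T) bs) <= Z}]) \/
  (exists K : {set T}, [/\ K \subset Z, #|Z| <= #|K| + 2 * j &
     forall x y, x \in K -> y \in K -> x != y -> ~~ B x y]).
Proof.
elim: j Z => [|j IH] Z; first by left; exists [::]; split.
have [/existsP[x /existsP[y /and4P[xZ yZ nxy Bxy]]] | no] :=
  boolP [exists x, [exists y, [&& x \in Z, y \in Z, x != y & B x y]]].
  have cZ : #|Z| = #|Z :\ x :\ y|.+2.
    by rewrite (cardsD1 x Z) xZ (cardsD1 y (Z :\ x)) !inE eq_sym nxy yZ.
  have sZ : Z :\ x :\ y \subset Z by apply/subsetP => z; rewrite !inE => /and3P[].
  have [[bs [sb pb szb ub sub]] | [K [sK cK nK]]] := IH (Z :\ x :\ y).
    left; exists ((x, [:: y]) :: bs); split => //=.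
    - by rewrite sb.
    - by move=> c; rewrite inE => /predU1P[->|/pb] //=; rewrite Bxy.
    - by rewrite szb; nlia.
    - have xs : x \notin flatten [seq block_seq i | i <- bs] by apply/negP => /sub; rewrite !inE eqxx andbF.
      have ys : y \notin flatten [seq block_seq i | i <- bs] by apply/negP => /sub; rewrite !inE eqxx.
      by rewrite inE negb_or nxy xs ys.
    - move=> z; rewrite !inE => /or3P[/eqP->|/eqP->|/sub] //.
      by rewrite !inE => /and3P[].
  right; exists K; split => //; first exact: subset_trans sZ.
  by rewrite cZ; nlia.
right; exists Z; split => //; first by nlia.
move=> x y xZ yZ nxy; apply/negP => Bxy; case/negP: no.
by apply/existsP; exists x; apply/existsP; exists y; rewrite xZ yZ nxy.
Qed.

Section Extend.
Variables (T : finType) (R B : rel T).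
Hypotheses (R_sym : symmetric R) (B_sym : symmetric B).
Hypothesis RB : forall x y, x != y -> ~~ R x y -> B x y.

Lemma cycle_through_clique (K : {set T}) q p q' y y' j :
  (forall u v, u \in K -> v \in K -> u != v -> R u v) ->
  path R q (rcons p q') -> uniq (q :: rcons p q') ->
  (forall x, x \in q :: rcons p q' -> x \notin K) ->
  y \in K -> y' \in K -> y != y' -> R y q -> R y' q' -> j + 2 <= #|K| ->
  exists s, [/\ cycle R s, uniq s, size s = size p + j + 4 &
    forall x, x \in s -> (x \in K) || (x \in q :: rcons p q')].
Proof.
move=> cK pq uq dK yK y'K nyy' Ryq Ry'q' leK.
have cK2 : #|K| = #|K :\ y :\ y'|.+2.
  by rewrite (cardsD1 y K) yK (cardsD1 y' (K :\ y)) !inE eq_sym nyy' y'K.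
have [|ks [uks sks subks]] := @take_enum _ (K :\ y :\ y') j; first by nlia.
have uk : uniq (y' :: rcons ks y).
  rewrite /= mem_rcons inE negb_or eq_sym nyy' rcons_uniq uks andbT /=.
  by apply/andP; split; apply/negP => /subks; rewrite !inE eqxx ?andbF.
have subk : {subset y' :: rcons ks y <= K}.
  move=> z; rewrite inE mem_rcons inE => /or3P[/eqP->|/eqP->|/subks] //.
  by rewrite !inE => /and3P[].
exists ((q :: rcons p q') ++ y' :: rcons ks y); split.
- rewrite /= rcons_cat cat_path pq /= last_rcons R_sym Ry'q' /=.
  by rewrite rcons_path last_rcons Ryq andbT; apply: (clique_path cK).
- rewrite cat_uniq uq uk andbT; apply/hasPn => x /subk; apply: contraL; exact: dK.
- by rewrite size_cat /= !size_rcons sks; nlia.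
by move=> x; rewrite mem_cat => /orP[->|/subk ->]; rewrite ?orbT.
Qed.

(** For two such vertices u, the pairs formed by u and its predecessor on Q are what [cycle_insert2]
    needs to insert y and y' together. *)
Lemma overlap_le1 (X : {set T}) (Q : seq T) k y y' :
  cycle R Q -> uniq Q -> size Q = 2 * k -> {subset Q <= X} ->
  ~ has_cycle R X (2 * k.+1) ->
  y \in X -> y' \in X -> y \notin Q -> y' \notin Q -> y != y' ->
  #|[set u in Q | R y' u && R y (prev Q u)]| <= 1.
Proof.
move=> cQ uQ sQ subQ noc yX y'X yQ y'Q nyy'; rewrite leqNgt; apply/negP => /card_gt1P.
case=> u1 [u2 []]; rewrite !inE => /and3P[u1Q Ry'u1 Ryu1] /and3P[u2Q Ry'u2 Ryu2] nu.
have np : prev Q u1 != prev Q u2 by apply: contra nu => /eqP /(can_inj (next_prev uQ)) ->.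
have [||||||s [cs us pms]] :=
  @cycle_insert2 _ R R_sym Q y y' (prev Q u1) (prev Q u2) cQ uQ nyy' yQ y'Q _ _ np.
1-6: by rewrite ?mem_prev ?next_prev.
case: noc; exists s; split=> //.
  by rewrite (perm_size pms) /= sQ mulnS.
by move=> x; rewrite (perm_mem pms) !inE => /or3P[/eqP->|/eqP->|/subQ].
Qed.

(* Two outside vertices whose R-neighbourhoods overlap after a shift along Q give the longer
   R-cycle.  So either all outside vertices have many common B-neighbours on Q, or two of
   them have so many R-neighbours that nearly all shifted ones are B-adjacent to the rest. *)
Lemma extend_cycle (X : {set T}) (Q : seq T) k m :
  cycle R Q -> uniq Q -> size Q = 2 * k -> {subset Q <= X} ->
  15 <= m -> m <= k.+1 -> 2 * k + m + 30 <= #|X| ->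
  has_cycle R X (2 * k.+1) \/ has_cycle B X (2 * m).
Proof.
move=> cQ uQ sQ subQ lem lemk leX.
have [|noc] := has_cycleP R X (2 * k.+1); [by left | right].
pose QS := [set x in Q].
have cQS : #|QS| = 2 * k by rewrite cardsE -sQ; apply/card_uniqP.
have sQX : QS \subset X by apply/subsetP => x; rewrite inE => /subQ.
pose Y := X :\: QS.
have cY : #|Y| = #|X| - 2 * k by rewrite cardsD (setIidPr sQX) cQS.
have YX y : y \in Y -> y \in X by rewrite inE => /andP[].
have YQ y : y \in Y -> y \notin Q by rewrite !inE => /andP[].
have bip (U : {set T}) (ys : seq T) : U \subset QS -> uniq ys -> size ys = m -> {subset ys <= Y} ->
    (forall y z, y \in ys -> z \in ys -> m <= #|[set u in U | B y u && B u z]|) ->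
    has_cycle B X (2 * m).
  move=> sU uys sys subys cU.
  have [||| s [cs us ss subs]] := @greedy_bipartite _ B U ys _ uys.
  - by rewrite sys; nlia.
  - move=> y /subys /YQ; apply: contra => /(subsetP sU); by rewrite inE.
  - by rewrite sys.
  exists s; split => //; first by rewrite ss sys.
  by move=> x /subs /orP[/(subsetP sU)/(subsetP sQX)|/subys/YX].
have [/forall_inP all1 | ] := boolP [forall y in Y, [forall z in Y, (y != z) ==>
    (m <= #|[set u in QS | B y u && B u z]|)]].
  have [|ys [uys sys subys]] := @take_enum _ Y m; first by nlia.
  apply: (bip QS ys) => // y z /subys yY /subys zY.
  have [<-|nyz] := eqVneq y z; last first.
    by have /forall_inP/(_ z zY)/implyP/(_ nyz) := all1 y yY.
  have /card_gt0P[z'] : 0 < #|Y :\ y|.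
    by move: (cardsD1 y Y); rewrite yY; nlia.
  rewrite in_setD1 => /andP[nz' z'Y].
  have /forall_inP/(_ z' z'Y)/implyP := all1 y yY.
  rewrite eq_sym => /(_ nz') /leq_trans; apply; apply: subset_leq_card.
  apply/subsetP => u; rewrite !in_set => /and3P[-> Byu _] /=.
  by rewrite Byu B_sym Byu.
rewrite negb_forall_in => /exists_inP[y0 y0Y]; rewrite negb_forall_in => /exists_inP[y1 y1Y].
rewrite negb_imply -ltnNge => /andP[n01 lt01].
pose U0 := [set q in QS | R y0 q || R y1 q].
pose U := [set next Q q | q in U0].
(* The successor map is injective, and a vertex of Q outside [U0] is a common B-neighbour of [y0]
   and [y1], of which there are fewer than m. *)
have cU : 2 * k < #|U| + m.
  rewrite card_imset; last by apply: (can_inj (prev_next uQ)).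
  have : QS \subset U0 :|: [set u in QS | B y0 u && B u y1].
    apply/subsetP => q; rewrite !in_set => qQ; rewrite qQ /=.
    have [|n0] := boolP (R y0 q) => //=; have [|n1] := boolP (R y1 q) => //=.
    rewrite RB //=; last by apply: contraTneq qQ => <-; apply: YQ.
    by rewrite B_sym RB //; apply: contraTneq qQ => <-; apply: YQ.
  move/subset_leq_card; rewrite cQS.
  have [+ _] := leq_card_setU U0 [set u in QS | B y0 u && B u y1]; nlia.
have sUQ : U \subset QS by apply/subsetP => u /imsetP[q]; rewrite !inE => /andP[qQ _] ->; rewrite mem_next.
pose Z := Y :\ y0 :\ y1.
have cZ : #|Y| = #|Z|.+2.
  by rewrite (cardsD1 y0 Y) y0Y (cardsD1 y1 (Y :\ y0)) !in_setD1 eq_sym n01 y1Y.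
have ZY z : z \in Z -> z \in Y by rewrite !in_setD1 => /and3P[].
have cUB y : y \in Z -> #|[set u in U | ~~ B y u]| <= 2.
  rewrite !in_setD1 => /and3P[ny1 ny0 yY].
  have o0 := overlap_le1 cQ uQ sQ subQ noc (YX _ y0Y) (YX _ yY) (YQ _ y0Y) (YQ _ yY).
  have o1 := overlap_le1 cQ uQ sQ subQ noc (YX _ y1Y) (YX _ yY) (YQ _ y1Y) (YQ _ yY).
  rewrite eq_sym in ny0; rewrite eq_sym in ny1.
  apply: leq_trans (leq_add (o0 ny0) (o1 ny1)).
  apply: leq_trans (leq_card_setU _ _).1; apply: subset_leq_card; apply/subsetP => u.
  rewrite !inE => /andP[/imsetP[q]]; rewrite !inE => /andP[qQ Rq] -> nB.
  have -> : R y (next Q q).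
    apply: contraNT nB; apply: RB; apply: contraTneq yY => ->.
    by rewrite !inE mem_next qQ.
  by rewrite mem_next qQ prev_next.
have cUBB y z : y \in Z -> z \in Z -> #|U| - 4 <= #|[set u in U | B y u && B u z]|.
  move=> /cUB cy /cUB cz.
  have : U \subset [set u in U | B y u && B u z] :|:
      ([set u in U | ~~ B y u] :|: [set u in U | ~~ B z u]).
    apply/subsetP => u uU; rewrite !in_set uU /= [B u z]B_sym.
    by case: (B y u); case: (B z u).
  move/subset_leq_card.
  have [+ _] := leq_card_setU [set u in U | B y u && B u z]
    ([set u in U | ~~ B y u] :|: [set u in U | ~~ B z u]).
  have [+ _] := leq_card_setU [set u in U | ~~ B y u] [set u in U | ~~ B z u].
  nlia.
have [leU|ltU] := leqP (m + 4) #|U|.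
  have [|ys [uys sys subys]] := @take_enum _ Z m; first by nlia.
  apply: (bip U ys) => //; first by move=> x /subys /ZY.
  by move=> y z /subys yZ /subys zZ; apply: leq_trans (cUBB y z yZ zZ); nlia.
(* Now m - 1 <= |U| <= m + 3 and k <= m + 1. Two vertices of Z are only known to share m - 5
   neighbours in U, so five connectors have to be saved. Ten disjoint B-edges do this: the blocks
   are these edges and m - 15 single vertices, and with m - 5 connectors there are (m - 5) + 20 + (m
   - 15) = 2m vertices. *)
have [[bs [sb pb szb ub sub]] | [K [sK cK nK]]] := matching_or_independent B 10 Z.
  pose Z1 := Z :\: [set x in flatten (map (@block_seq T) bs)].
  have cZ1 : #|Z| <= #|Z1| + 20.
    rewrite -(cardsID [set x in flatten (map (@block_seq T) bs)] Z) -/Z1 addnC leq_add2l.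
    apply: leq_trans (subset_leq_card (subsetIr _ _)) _.
    by rewrite cardsE (leq_trans (card_size _)) ?szb.
  have [|ys [uys sys subys]] := @take_enum _ Z1 (m - 15); first by nlia.
  pose cs := bs ++ map (fun x => (x, [::])) ys.
  have csf : flatten (map (@block_seq T) cs) = flatten (map (@block_seq T) bs) ++ ys.
    by rewrite map_cat flatten_cat size_block1.
  have fZ x : x \in flatten (map (@block_seq T) cs) -> x \in Z.
    by rewrite csf mem_cat => /orP[/sub|/subys] //; rewrite inE => /andP[].
  have csZ c : c \in cs -> c.1 \in Z /\ block_end c \in Z.
    move=> ccs; have f x : x \in block_seq c -> x \in Z.
      by move=> xc; apply: fZ; apply/flattenP; exists (block_seq c) => //; apply: map_f.
    by split; apply: f; [rewrite mem_head | rewrite mem_last].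
  have [||||||s [us [ccs us' pms sus subus]]] := @greedy_cycle _ B U (m - 5) cs.
  - by rewrite size_cat sb.
  - by rewrite size_cat sb size_map sys; nlia.
  - by move=> c; rewrite mem_cat => /orP[/pb//|/mapP[x _ ->]].
  - move=> c d /csZ[_ cZc] /csZ[dZ _]; apply: leq_trans (cUBB _ _ cZc dZ); nlia.
  - rewrite csf cat_uniq ub uys andbT; apply/hasPn => x /subys.
    by rewrite !inE => /andP[].
  - by move=> x /fZ/ZY/YQ; apply: contra => /(subsetP sUQ); rewrite inE.
  exists s; split => //.
    rewrite (perm_size pms) size_cat sus csf !size_cat szb size_map sb sys; nlia.
  move=> x; rewrite (perm_mem pms) mem_cat => /orP[/subus/(subsetP sUQ)/(subsetP sQX)//|].
  by move=> /fZ/ZY/YX.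
have KY y : y \in K -> y \in Y by move/(subsetP sK)/ZY.
have cliqueK u v : u \in K -> v \in K -> u != v -> R u v.
  by move=> uK vK nuv; apply: contraNT (nK _ _ uK vK nuv); apply: RB.
have [/existsP[y /existsP[y' /existsP[q /existsP[q']]]] | no2] :=
  boolP [exists y, [exists y', [exists q, [exists q',
    [&& y \in K, y' \in K, y != y', q \in Q & [&& q' \in Q, q != q', R y q & R y' q']]]]]].
  case/and5P=> yK y'K nyy' qQ /and4P[q'Q nqq' Ryq Ry'q']; case: noc.
  (* The longer arc of Q is kept, so at most k - 1 inner vertices have to be made up for inside K,
     which is large enough for that; the two ends in K supply the increase of the length by 2. *)
  have aux q1 q2 y1' y2' p1 p2 : perm_eq Q (q1 :: p1 ++ q2 :: p2) ->
      cycle R (q1 :: p1 ++ q2 :: p2) -> y1' \in K -> y2' \in K -> y1' != y2' ->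
      R y1' q1 -> R y2' q2 -> size p2 <= size p1 -> has_cycle R X (2 * k.+1).
    move=> pm cR y1K y2K n12 R1 R2 les.
    have spm : size p1 + size p2 + 2 = 2 * k by rewrite -sQ (perm_size pm) /= size_cat /=; nlia.
    have memq x : x \in q1 :: rcons p1 q2 -> x \in Q.
      by rewrite (perm_mem pm) -cat_cons -cat_rcons mem_cat => ->.
    have pR : path R q1 (rcons p1 q2).
      by move: cR; rewrite /= rcons_cat rcons_cons -cat_rcons cat_path => /andP[].
    have uR : uniq (q1 :: rcons p1 q2).
      by move: uQ; rewrite (perm_uniq pm) -cat_cons -cat_rcons cat_uniq => /andP[].
    have [||s [cs us ss subs]] :=
      @cycle_through_clique K q1 p1 q2 y1' y2' (size p2) cliqueK pR uR _ y1K y2K n12 R1 R2.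
    - by move=> x /memq; apply: contraL => /KY/YQ.
    - by nlia.
    exists s; split => //; first by rewrite ss mulnS -spm [RHS]addnC -[RHS]addnA.
    by move=> x /subs /orP[/KY/YX|/memq/subQ].
  have [i p1 p2 _ _ def] := rot_to_arc uQ qQ q'Q nqq'.
  have pm : perm_eq Q (q :: p1 ++ q' :: p2) by rewrite -def perm_sym perm_rot.
  have cR : cycle R (q :: p1 ++ q' :: p2) by rewrite -def rot_cycle.
  have [le12|le21] := leqP (size p2) (size p1); first exact: (aux q q' y y' p1 p2).
  apply: (aux q' q y' y p2 p1) => //; last exact: ltnW.
  - by apply: (perm_trans pm); rewrite -(cat_cons q p1) -(cat_cons q' p2) perm_catC.
  - by rewrite -(rot_cycle (size (q :: p1))) -cat_cons rot_size_cat in cR.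
  - by rewrite eq_sym.
(* Without two disjoint R-edges between K and Q, deleting the ends of any one such edge destroys all
   of them. *)
have [ys' [qs' Bcomplete]] : exists ys' qs', forall y q, y \in K -> y != ys' -> q \in Q -> q != qs' -> B y q.
  have [/existsP[y' /existsP[q' /and3P[y'K q'Q Ry'q']]] | no1] :=
    boolP [exists y, [exists q, [&& y \in K, q \in Q & R y q]]].
    exists y', q' => y q yK ny qQ nq; apply: RB; first by apply: contraTneq qQ => <-; apply/YQ/KY.
    apply: contra no2 => Ryq.
    apply/existsP; exists y'; apply/existsP; exists y; apply/existsP; exists q'; apply/existsP; exists q.
    by rewrite y'K yK eq_sym ny q'Q qQ eq_sym nq Ry'q' Ryq.
  exists y0, y0 => y q yK ny qQ nq; apply: RB; first by apply: contraTneq qQ => <-; apply/YQ/KY.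
  apply: contra no1 => Ryq.
  by apply/existsP; exists y; apply/existsP; exists q; rewrite yK qQ.
have [|ys [uys sys subys]] := @take_enum _ (K :\ ys') m.
  by have := cardsD1 ys' K; nlia.
have subK x : x \in ys -> x \in K /\ x != ys' by move/subys; rewrite !inE => /andP[].
apply: (bip (QS :\ qs') ys) => //.
- by apply: subD1set.
- by move=> x /subK[/KY].
move=> y z /subK[yK ny] /subK[zK nz].
have -> : [set u in QS :\ qs' | B y u && B u z] = QS :\ qs'.
  apply/setP => u; rewrite !inE; case: eqP => //= /eqP nu; case: (boolP (u \in Q)) => //= uQ'.
  by rewrite Bcomplete //= B_sym Bcomplete.
by have := cardsD1 qs' QS; nlia.
Qed.

End Extend.

(** * Even cycles in two colours *)

Lemma clique_cycle (T : finType) (e : rel T) (K : {set T}) j :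
  (forall u v, u \in K -> v \in K -> u != v -> e u v) ->
  2 <= j -> j <= #|K| -> has_cycle e K j.
Proof.
move=> cK j2 /take_enum[[|x [|y s]] [us ss subs]]; try by move: ss j2 => <-.
exists [:: x, y & s]; split => //.
rewrite /cycle rcons_path (clique_path cK) //.
have lK : last x (y :: s) \in y :: s by rewrite /= mem_last.
rewrite cK ?subs ?mem_head //; first by rewrite inE lK orbT.
by apply: contraTneq lK => ->; case/andP: us.
Qed.

(** Induction on m + n. If m < n, a B-cycle of length 2n - 2 is extended; if m = n, an R-cycle of
    length 2m - 2. The base case m = n = 15 is a monochromatic clique on 30 vertices. *)
Lemma cycle_ramsey : exists C : nat, forall (m n : nat) (T : finType) (R B : rel T) (X : {set T}),
  symmetric R -> symmetric B -> (forall x y, x != y -> R x y || B x y) ->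
  15 <= m -> m <= n -> 2 * n + m + C <= #|X| ->
  has_cycle R X (2 * m) \/ has_cycle B X (2 * n).
Proof.
have [N HN] := ramsey_clique 30 30.
exists (N + 30) => m n; have [k] := ubnP (m + n).
elim: k m n => // k IH m n ltk T R B X R_sym B_sym RB lem lemn leX.
have RB' x y : x != y -> ~~ R x y -> B x y by move=> /RB; case: (R x y).
have BR' x y : x != y -> ~~ B x y -> R x y by move=> /RB; case: (B x y) => //; rewrite orbF.
have [ltmn|lenm] := ltnP m n.
  have [|||?|[Q [cQ uQ sQ subQ]]] := IH m n.-1 _ T R B X R_sym B_sym RB lem; try by nlia.
    by left.
  have [||?|?] := @extend_cycle T B R B_sym R_sym BR' X Q n.-1 m cQ uQ sQ subQ lem; try by nlia.
    by right; rewrite -(@prednK n) //; nlia.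
  by left.
have emn : m = n by nlia.
subst n; have [ltm|lem'] := ltnP 15 m.
  have [||||[Q [cQ uQ sQ subQ]]|?] := IH m.-1 m _ T R B X R_sym B_sym RB; try by nlia.
    have [||?|?] := @extend_cycle T R B R_sym B_sym RB' X Q m.-1 m cQ uQ sQ subQ lem; try by nlia.
      by left; rewrite -(@prednK m) //; nlia.
    by right.
  by right.
have em : m = 15 by nlia.
subst m; pose c (S : {set T}) := [exists x in S, exists y in S, (x != y) && R x y].
have cE x y : x != y -> c [set x; y] = R x y.
  move=> nxy; apply/exists_inP/idP => [[u + /exists_inP[v]]|Rxy].
    rewrite !inE => /orP[]/eqP-> /orP[]/eqP->; rewrite ?eqxx // => /andP[_] //.
    by rewrite R_sym.
  by exists x; rewrite ?inE ?eqxx //; apply/exists_inP; exists y; rewrite ?inE ?eqxx ?orbT ?nxy.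
have [|S [i [leS [sSX cS]]]] := HN T c X; first by nlia.
case: i leS cS => leS cS; [left|right]; apply: has_cycleS sSX _; apply: clique_cycle leS => //.
  by move=> u v uS vS nuv; rewrite -cE // cS.
by move=> u v uS vS nuv; apply: RB' => //; rewrite -cE // cS.
Qed.

(** * Bicliques along a path *)

Lemma first_last (T : eqType) (a : pred T) (p : seq T) :
  1 < count a p -> exists r1 x r2 y r3, [/\ p = r1 ++ x :: r2 ++ y :: r3, a x, a y &
    forall z, z \in p -> a z -> z \in x :: rcons r2 y].
Proof.
move=> ca; have ha : has a p by rewrite has_count; apply: ltnW.
case: (split_find ha) ca => x r1 r3 ax nr1 ca.
have {ca}: 0 < count a r3.
  by move: ca; rewrite count_cat -cats1 count_cat /= ax (eqP (_ : count a r1 == 0)) //= -leqn0 leqNgt -has_count.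
rewrite -(count_rev a) -has_count => hb.
move def: (rev r3) hb => q hb; move: def; case: (split_find hb) => y s1 s2 ay ns1 def.
have -> : r3 = rev s2 ++ y :: rev s1 by rewrite -[r3]revK def rev_cat rev_rcons.
exists r1, x, (rev s2), y, (rev s1); split => //; first by rewrite cat_rcons.
move=> z; rewrite !(mem_cat, mem_rcons, inE) !mem_rev => zin az.
have nz1 : z \in r1 = false by apply: contraNF nr1 => zr; apply/hasP; exists z.
have nz2 : z \in s1 = false by apply: contraNF ns1 => zr; apply/hasP; exists z.
by move: zin; rewrite nz1 nz2 orbF; case: (z == x); case: (z == y); case: (z \in s2).
Qed.

Lemma dense_chunk (T : eqType) (a : pred T) (k t n : nat) (r : seq T) :
  size r <= n * k -> n * t < count a r ->
  exists c1 c2 c3, [/\ r = c1 ++ c2 ++ c3, size c2 <= k & t <= count a c2].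
Proof.
elim: n r => [|n IH] r; first by case: r.
rewrite !mulSn => szr cr; have [le|lt] := leqP t (count a (take k r)).
  by exists [::], (take k r), (drop k r); rewrite /= cat_take_drop size_take geq_minl.
have [||c1 [c2 [c3 [def sc cc]]]] := IH (drop k r).
- by rewrite size_drop leq_subLR.
- by move: cr; rewrite -{1}(cat_take_drop k r) count_cat; nlia.
exists (take k r ++ c1), c2, c3; split => //.
by rewrite -catA -def cat_take_drop.
Qed.

Section Dense.
Variables (T : finType) (e : rel T).

(* Double counting followed by pigeonhole on the traces on S. *)
Lemma common_trace (S V0 : {set T}) (d t : nat) :
  0 < d -> 0 < t -> (forall x, x \in S -> d <= #|[set v in V0 | e x v]|) ->
  #|V0| <= 8 * d -> 16 * t <= #|S| ->
  exists A B : {set T}, [/\ A \subset S, B \subset V0, t <= #|A|,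
    d <= 2 ^ #|S|.+1 * #|B| & forall x y, x \in A -> y \in B -> e x y].
Proof.
move=> d0 t0 degS leV leS.
pose tr v := [set x in S | e x v].
pose G := [set v in V0 | t <= #|tr v|].
have sumE : \sum_(x in S) #|[set v in V0 | e x v]| = \sum_(v in V0) #|tr v|.
  transitivity (\sum_(x in S) \sum_(v in V0 | e x v) 1).
    by apply: eq_bigr => x _; rewrite sum1dep_card; apply: eq_card => v; rewrite !inE.
  rewrite (exchange_big_dep (fun v => v \in V0)) //=; last by move=> x v _ /andP[].
  apply: eq_bigr => v vV; rewrite sum1dep_card; apply: eq_card => x.
  by rewrite !inE vV.
(* Vertices with trace below t carry at most |V0| t <= 8dt <= d |S| / 2 edges to S, so at least half
   of the |S| d edges go to [G]. *)
have leG : d <= 2 * #|G|.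
  have h1 : #|S| * d <= \sum_(x in S) #|[set v in V0 | e x v]|.
    by rewrite -sum_nat_const; apply: leq_sum.
  have h2 : \sum_(v in V0) #|tr v| <= #|G| * #|S| + #|V0| * t.
    rewrite -!sum_nat_const.
    have -> : \sum_(i in G) #|S| = \sum_(i in V0) (if i \in G then #|S| else 0).
      rewrite -big_mkcondr; apply: eq_bigl => v; rewrite inE andbA andbb //.
    rewrite -big_split; apply: leq_sum => v vV /=; rewrite !inE vV /=.
    have [le|lt] := leqP t #|tr v|; last by rewrite add0n ltnW.
    by apply: leq_trans (leq_addr _ _); apply: subset_leq_card; apply/subsetP => x; rewrite inE => /andP[].
  rewrite sumE in h1; have := leq_trans h1 h2; nia.
pose fib A := [set v in G | tr v == A].
have [/exists_inP[A AS leA] | no] := boolP [exists A in powerset S, d <= 2 ^ #|S|.+1 * #|fib A|].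
  exists A, (fib A); rewrite powersetE in AS; split => //.
  - by apply/subsetP => v; rewrite !inE => /andP[/andP[]].
  - have /card_gt0P[v] : 0 < #|fib A| by rewrite lt0n; apply: contraTneq leA => ->; rewrite muln0 -ltnNge.
    by rewrite !inE => /andP[/andP[_ le] /eqP <-].
  - by move=> x v xA; rewrite !inE => /andP[_ /eqP def]; move: xA; rewrite -def inE => /andP[].
rewrite negb_exists_in in no; case/negP: (ltnn (2 ^ #|S| * d)).
have cG : #|G| = \sum_(A in powerset S) #|fib A|.
  rewrite -sum1_card (partition_big tr (fun A => A \in powerset S)) /=; last first.
    by move=> v _; rewrite powersetE; apply/subsetP => x; rewrite inE => /andP[].
  by apply: eq_bigr => A _; rewrite sum1dep_card; apply: eq_card => v; rewrite !inE.
have : \sum_(A in powerset S) (2 ^ #|S|.+1 * #|fib A|).+1 <= \sum_(A in powerset S) d.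
  by apply: leq_sum => A AS; rewrite ltnNge; apply: (forall_inP no).
under eq_bigr do rewrite -addn1.
rewrite big_split /= -big_distrr /= -cG !sum_nat_const card_powerset muln1 expnS.
have := expn_gt0 2 #|S|; set f := 2 ^ _; nia.
Qed.

(** A complete pair A, B sitting on a sequence: A fills a short window from a to a', and B lies
    either off the sequence or in a later short window from b to b'. The interior of each window has
    odd size, so that the shortcuts through A and B preserve parity; the bound 3 makes replacing
    [r2] by a single vertex a true shortening. *)
Variant bundle (t K : nat) (V0 : {set T}) : seq T -> Prop :=
| OffBundle r1 a r2 a' r3 (A B : {set T}) of
    odd (size r2) & 3 <= size r2 <= K & a \in A & a' \in A &
    {subset A <= a :: rcons r2 a'} & t <= #|A| & t <= #|B| & B \subset V0 &
    (forall x y, x \in A -> y \in B -> e x y) &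
    (forall y, y \in B -> y \notin r1 ++ a :: r2 ++ a' :: r3) :
    bundle t K V0 (r1 ++ a :: r2 ++ a' :: r3)
| OnBundle r1 a r2 a' u1 b u2 b' u3 (A B : {set T}) of
    odd (size r2) & 3 <= size r2 <= K & a \in A & a' \in A &
    {subset A <= a :: rcons r2 a'} & t <= #|A| & t <= #|B| &
    odd (size u2) & size u2 <= K & b \in B & b' \in B &
    {subset B <= b :: rcons u2 b'} &
    (forall x y, x \in A -> y \in B -> e x y) :
    bundle t K V0 (r1 ++ a :: r2 ++ a' :: u1 ++ b :: u2 ++ b' :: u3).

Lemma count_set (A : {set T}) p : uniq p -> {subset A <= p} -> count [in A] p = #|A|.
Proof.
move=> up sub; rewrite -size_filter -(card_uniqP _) ?filter_uniq //.
apply: eq_card => x; rewrite mem_filter; case xA : (x \in A) => //=; exact: sub.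
Qed.

(** With f = 2^(16t + 1), [common_trace] gives d <= f |B0|, hence |B0| >= 200t. Unless t vertices of
    [B0] lie off p, most of [B0] comes after a'. The tail there has at most 8d <= 8f |B0| vertices,
    so [B0] is dense enough in it for some stretch of length 64tf to contain t of its vertices in
    positions of one parity. *)
Lemma bundle_explicit (t d : nat) (V0 : {set T}) p : 2 <= t ->
  2 ^ (16 * t).+1 * (200 * t) + 1 <= d -> #|V0| <= 8 * d -> uniq p -> {subset p <= V0} -> 64 * t <= size p ->
  (forall x, x \in p -> d <= #|[set v in V0 | e x v]|) ->
  bundle t (64 * t + 64 * t * 2 ^ (16 * t).+1) V0 p.
Proof.
pose s := 16 * t; rewrite -[16 * t]/s; set f := 2 ^ s.+1 => t2 led leV up sub lep1 deg.
have f0 : 0 < f by rewrite expn_gt0.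
have [x0 _] : exists x0 : T, x0 \in p by case: (p) lep1 => [|x r]; [move=> /=; nlia | exists x; rewrite mem_head].
have szp : 4 * s <= size p by rewrite /s; nlia.
(* Between two positions divisible by 4 there is an odd number of vertices, at least 3. *)
pose S := [set nth x0 p (4 * (i : 'I_s)) | i : 'I_s].
have cS : #|S| = s.
  rewrite card_imset ?card_ord // => i j /eqP; rewrite nth_uniq //; try by have := ltn_ord i; have := ltn_ord j; nlia.
  by rewrite eqn_mul2l /= => /eqP h; apply: val_inj.
have Sp x : x \in S -> x \in p.
  by case/imsetP => i _ ->; apply: mem_nth; have := ltn_ord i; nlia.
have S4 x : x \in S -> exists2 i, i < s & index x p = 4 * i.
  by case/imsetP => i _ ->; exists i => //; rewrite index_uniq //; have := ltn_ord i; nlia.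
have [||||| A [B0 [sAS sBV leA leB ABe]]] := @common_trace S V0 d t.
- by nlia.
- by nlia.
- by move=> x /Sp/deg.
- by [].
- by rewrite cS.
rewrite cS -/f in leB.
have AS x : x \in A -> x \in S by apply: subsetP.
have [|r1 [a [r2 [a' [r3 [def aA a'A Aar]]]]]] := @first_last _ [in A] p.
  by rewrite count_set ?(leq_trans t2) // => x /AS/Sp.
have {}Aar : {subset A <= a :: rcons r2 a'} by move=> x xA; apply: Aar => //; apply/Sp/AS.
have upd := up; rewrite def in upd.
have [ia lia ea] := S4 a (AS a aA); have [ia' lia' ea'] := S4 a' (AS a' a'A).
have ia1 : index a p = size r1.
  move: upd; rewrite def cat_uniq index_cat /= eqxx addn0 => /and3P[_ + _].
  by rewrite /= negb_or => /andP[/negbTE-> _].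
have ia2 : index a' p = size r1 + (size r2).+1.
  rewrite def -cat_cons catA index_cat.
  move: upd; rewrite -cat_cons catA cat_uniq /= negb_or => /and3P[_ /andP[/negbTE -> _] _].
  by rewrite eqxx addn0 size_cat.
have or2 : odd (size r2).
  have : (size r2).+1 = 4 * (ia' - ia) by nlia.
  by move/(congr1 odd); rewrite oddM /=; case: (odd _).
have sr2 : 3 <= size r2 <= 64 * t + 64 * t * f.
  by apply/andP; split; rewrite ?/s in lia lia' *; nlia.
have q200 : 200 * t <= #|B0|.
  have : f * (200 * t) <= f * #|B0| by nlia.
  by rewrite leq_pmul2l.
have [leoff|ltoff] := leqP t #|B0 :\: [set x in p]|.
  rewrite def; apply: (@OffBundle t _ V0 r1 a r2 a' r3 A (B0 :\: [set x in p])) => //.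
  - by apply: subset_trans sBV; apply: subsetDl.
  - by move=> x y xA; rewrite inE => /andP[_ yB]; apply: ABe.
  - by move=> y; rewrite -def !inE => /andP[].
have B3 : #|B0| <= #|[set x in B0 | x \in r3]| + t + 4 * s.
  have sub3 : B0 \subset [set x in B0 | x \in r3] :|: ((B0 :\: [set x in p]) :|: [set x in r1 ++ a :: rcons r2 a']).
    apply/subsetP => x xB; rewrite !inE xB /= def !(mem_cat, inE, mem_rcons).
    by case: (x == a); case: (x == a'); case: (x \in r1); case: (x \in r2); case: (x \in r3); rewrite ?orbT.
  have := subset_leq_card sub3.
  have [+ _] := leq_card_setU [set x in B0 | x \in r3] ((B0 :\: [set x in p]) :|: [set x in r1 ++ a :: rcons r2 a']).
  have [+ _] := leq_card_setU (B0 :\: [set x in p]) [set x in r1 ++ a :: rcons r2 a'].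
  have : #|[set x in r1 ++ a :: rcons r2 a']| <= size r1 + (size r2).+2.
    by rewrite cardsE (leq_trans (card_size _)) // size_cat /= size_rcons.
  nlia.
(* Two vertices in positions of equal parity have an odd number of vertices between them, as the
   second window requires. *)
pose par i := [set x in B0 | (x \in r3) && (odd (index x r3) == i)].
have [i lei] : exists i, #|B0| <= 2 * #|par i| + t + 4 * s.
  have sub2 : [set x in B0 | x \in r3] \subset par true :|: par false.
    by apply/subsetP => x; rewrite !inE => /andP[-> ->] /=; case: (odd _).
  have := subset_leq_card sub2.
  have [+ _] := leq_card_setU (par true) (par false).
  have [le|lt] := leqP #|par true| #|par false|; [exists false | exists true]; nlia.
have ur3 : uniq r3 by move: upd; rewrite cat_uniq /= cat_uniq /= => /and3P[_ _ /andP[_ /and4P[]]].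
have sr3 : size r3 <= 8 * d.
  apply: leq_trans leV; rewrite -(card_uniqP ur3); apply: subset_leq_card; apply/subsetP => x xr.
  by apply: sub; rewrite def !(mem_cat, inE) xr !orbT.
pose n := (#|B0| %/ (8 * t)).+1.
have nB : #|B0| < n * (8 * t) by rewrite ltn_ceil //; nlia.
have nB' : n * t <= #|B0| + t.
  rewrite mulSn addnC leq_add2r; apply: leq_trans (leq_trunc_div _ (8 * t)).
  by rewrite leq_mul2l; apply/orP; right; nlia.
have cpar : count [in par i] r3 = #|par i|.
  by apply: count_set => // x; rewrite !inE => /and3P[].
have nB8 : 8 * (n * t) <= #|B0| + 8 * t.
  have := leq_trunc_div #|B0| (8 * t); rewrite /n; nlia.
have [||c1 [c2 [c3 [defr sc cc]]]] := @dense_chunk _ [in par i] (64 * t * f) t n r3.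
- apply: (leq_trans sr3); apply: (@leq_trans (8 * (f * #|B0|))); first by rewrite leq_pmul2l.
  by move: nB; clear; nia.
- by rewrite cpar; rewrite ?/s in lei; nlia.
have [|u1 [b [u2 [b' [u3 [defc bB b'B Bb]]]]]] := @first_last _ [in par i] c2.
  by apply: leq_trans cc.
pose B := [set x in par i | x \in c2].
have uc2 : uniq c2 by move: ur3; rewrite defr !cat_uniq => /and3P[_ _ /and3P[]].
have cB : t <= #|B|.
  apply: (leq_trans cc); rewrite -(@count_set B c2) //; last by move=> x; rewrite !inE => /andP[].
  by rewrite (@eq_in_count _ [in par i] [in B]) // => x xc; rewrite !inE xc andbT.
have {}defr : r3 = (c1 ++ u1) ++ b :: u2 ++ b' :: (u3 ++ c3).
  by rewrite defr defc -!catA /= -!catA.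
rewrite def defr.
have bc2 : b \in c2 by rewrite defc !(mem_cat, inE) eqxx !orbT.
have b'c2 : b' \in c2 by rewrite defc !(mem_cat, inE) eqxx !orbT.
have ou2 : odd (size u2).
  have ib : index b r3 = size (c1 ++ u1).
    move: ur3; rewrite defr cat_uniq index_cat /= eqxx addn0 => /and3P[_ + _].
    by rewrite /= negb_or => /andP[/negbTE-> _].
  have ib' : index b' r3 = size (c1 ++ u1) + (size u2).+1.
    rewrite defr -cat_cons catA index_cat.
    move: ur3; rewrite defr -cat_cons catA cat_uniq /= negb_or => /and3P[_ /andP[/negbTE -> _] _].
    by rewrite eqxx addn0 size_cat.
  move: bB b'B; rewrite !inE => /and3P[_ _ /eqP e1] /and3P[_ _ /eqP e2].
  by move: e2; rewrite ib' oddD -ib e1 oddS; case: (i); case: (odd (size u2)).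
apply: (@OnBundle t _ V0 r1 a r2 a' (c1 ++ u1) b u2 b' (u3 ++ c3) A B) => //.
- apply: leq_trans (leq_addl _ _); apply: leq_trans sc.
  by rewrite defc size_cat /= size_cat /=; nlia.
- by rewrite inE bB bc2.
- by rewrite inE b'B b'c2.
- by move=> x; rewrite inE => /andP[xB xc]; apply: Bb.
- by move=> x y xA; rewrite !inE => /andP[/and3P[yB _ _] _]; apply: ABe.
Qed.

End Dense.

Lemma bundle_exists (t : nat) : 2 <= t ->
  exists K d0 : nat, forall (T : finType) (e : rel T) d (V0 : {set T}) p, d0 <= d -> #|V0| <= 8 * d -> uniq p -> {subset p <= V0} ->
  K <= size p -> (forall x, x \in p -> d <= #|[set v in V0 | e x v]|) ->
  bundle e t K V0 p.
Proof.
move=> t2; exists (64 * t + 64 * t * 2 ^ (16 * t).+1), (2 ^ (16 * t).+1 * (200 * t) + 1) => T e d V0 p led leV up sub lep deg.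
by apply: (bundle_explicit t2 led leV up sub _ deg); apply: leq_trans (leq_addr _ _) lep.
Qed.

(** * Even cycle lengths in dense graphs *)

Section Shorten.
Variables (T : finType) (e : rel T).
Hypothesis e_sym : symmetric e.

Lemma path_cat_cons x p1 y p2 :
  path e x (p1 ++ y :: p2) = path e x (rcons p1 y) && path e y p2.
Proof. by rewrite -cat_rcons cat_path last_rcons. Qed.

Lemma path_rev x p y : path e y (rcons (rev p) x) = path e x (rcons p y).
Proof.
rewrite -[rcons (rev p) x]rev_cons -(cats0 (rev _)) path_rev_cat //= andbT.
by rewrite rcons_path e_sym andbC.
Qed.

(** If B is off the path, one vertex of B replaces [r2]. Otherwise the path is rerouted as a, b,
    [u1] reversed, a', b', which drops [r2] and [u2]. As both interiors are odd, the loss is even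
    and positive. *)
Lemma bundle_shorten t K (V0 : {set T}) p x y : 1 < t ->
  bundle e t K V0 p -> uniq p -> {subset p <= V0} -> path e x (rcons p y) ->
  exists p', [/\ path e x (rcons p' y), uniq p', {subset p' <= V0},
    size p' < size p <= size p' + 2 * K & odd (size p') = odd (size p)].
Proof.
move=> t1; case.
  move=> r1 a r2 a' r3 A B or2 /andP[r23 r2K] aA a'A _ _ cB sBV ABe Boff up sub pe.
  have /card_gt0P[b bB] : 0 < #|B| by apply: leq_trans cB; apply: ltnW.
  have pm : perm_eq (r1 ++ a :: b :: a' :: r3) (b :: (r1 ++ [:: a]) ++ a' :: r3).
    apply/permP => f; rewrite /= !count_cat /= addn0; clear; nlia.
  have ss : subseq ((r1 ++ [:: a]) ++ a' :: r3) (r1 ++ a :: r2 ++ a' :: r3).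
    by rewrite -catA cat_subseq //= eqxx suffix_subseq // suffix_suffix.
  exists (r1 ++ a :: b :: a' :: r3); split.
  - move: pe; rewrite !rcons_cat !rcons_cons !rcons_cat rcons_cons.
    rewrite path_cat_cons [in X in _ -> X]path_cat_cons => /andP[-> /=].
    rewrite ABe // e_sym ABe //= path_cat_cons => /andP[_]; exact.
  - rewrite (perm_uniq pm) /= (subseq_uniq ss) // andbT.
    by apply/negP => /(mem_subseq ss); apply/negP/Boff.
  - move=> z; rewrite (perm_mem pm) inE => /predU1P[->|/(mem_subseq ss)/sub //].
    exact: (subsetP sBV).
  - by rewrite !size_cat /= !size_cat /=; nlia.
  by rewrite !size_cat /= !size_cat /=; move: or2; nlia.
move=> r1 a r2 a' u1 b u2 b' u3 A B or2 /andP[r23 r2K] aA a'A _ _ _ ou2 u2K bB b'B _ ABe up sub pe.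
have pm : perm_eq (r1 ++ a :: b :: rev u1 ++ a' :: b' :: u3) ((r1 ++ [:: a]) ++ (a' :: u1 ++ [:: b]) ++ b' :: u3).
  apply/permP => f; do 4!rewrite /= ?(count_cat, count_rev) /=; clear; nlia.
have ss : subseq ((r1 ++ [:: a]) ++ (a' :: u1 ++ [:: b]) ++ b' :: u3)
    ((r1 ++ [:: a]) ++ r2 ++ (a' :: u1 ++ [:: b]) ++ u2 ++ b' :: u3).
  apply: cat_subseq => //; apply: (subseq_trans _ (suffix_subseq r2 _)).
  by apply: cat_subseq => //; apply: suffix_subseq.
have eqp : r1 ++ a :: r2 ++ a' :: u1 ++ b :: u2 ++ b' :: u3 =
    (r1 ++ [:: a]) ++ r2 ++ (a' :: u1 ++ [:: b]) ++ u2 ++ b' :: u3.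
  by rewrite -!catA /= -!catA.
exists (r1 ++ a :: b :: rev u1 ++ a' :: b' :: u3); split.
- move: pe; rewrite !(rcons_cat, rcons_cons).
  rewrite path_cat_cons [in X in _ -> X]path_cat_cons => /andP[-> /=].
  rewrite ABe //= path_cat_cons => /andP[_]; rewrite path_cat_cons => /andP[pu].
  rewrite path_cat_cons => /andP[_ pb'].
  by rewrite path_cat_cons path_rev pu /= ABe.
- by rewrite (perm_uniq pm) (subseq_uniq ss) // -eqp.
- by move=> z; rewrite (perm_mem pm) => /(mem_subseq ss); rewrite -eqp => /sub.
- by rewrite !(size_cat, size_rev) /= !(size_cat, size_rev) /= !(size_cat, size_rev) /= !(size_cat, size_rev) /=; nlia.
by rewrite !(size_cat, size_rev) /= !(size_cat, size_rev) /= !(size_cat, size_rev) /= !(size_cat, size_rev) /=; move: or2 ou2; nlia.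
Qed.

End Shorten.

Lemma shorten_path : exists K d0 : nat, forall (T : finType) (e : rel T), symmetric e ->
  forall d (V0 : {set T}) p x y, d0 <= d -> #|V0| <= 8 * d -> uniq p -> {subset p <= V0} ->
  K <= size p -> (forall z, z \in p -> d <= #|[set v in V0 | e z v]|) ->
  path e x (rcons p y) ->
  exists p', [/\ path e x (rcons p' y), uniq p', {subset p' <= V0},
    size p' < size p <= size p' + K & odd (size p') = odd (size p)].
Proof.
have [K [d0 HK]] := @bundle_exists 2 isT.
exists (2 * K), d0 => T e e_sym d V0 p x y led leV up sub leK deg pe.
by apply: (@bundle_shorten _ e e_sym 2 K V0 p x y _ _ up sub pe) => //; apply: HK led _ _ _ _ _ => //; nlia.
Qed.

(** The path from a' to a is closed up by alternating through [j] vertices of B and j - 1 of A, so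
    the length is adjustable in steps of 2. *)
Lemma biclique_cycle (T : finType) (e : rel T) (V0 A B : {set T}) a a' p j :
  symmetric e -> 0 < j -> j <= #|A|.+1 -> j <= #|B| -> A \subset V0 -> B \subset V0 ->
  path e a' (rcons p a) -> uniq (a' :: rcons p a) -> {subset a' :: rcons p a <= V0} ->
  (forall x, x \in a' :: rcons p a -> x \notin A /\ x \notin B) -> [disjoint A & B] ->
  (forall x y, x \in a |: (a' |: A) -> y \in B -> e x y) ->
  has_cycle e V0 (size p + 1 + 2 * j).
Proof.
move=> e_sym j0 jA jB sA sB pe up sub dp dAB eAB.
have [|ys [uys sys subys]] := @take_enum _ A j.-1; first by nlia.
pose bs := (a', rcons p a) :: map (fun x => (x, [::])) ys.
have bsf : flatten (map (@block_seq T) bs) = (a' :: rcons p a) ++ ys by rewrite /= size_block1.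
have bsA c : c \in bs -> block_end c \in a |: (a' |: A) /\ c.1 \in a |: (a' |: A).
  rewrite inE => /predU1P[-> | /mapP[x /subys xA ->]].
    by rewrite /block_end /= last_rcons !inE !eqxx !orbT.
  by rewrite !inE xA !orbT.
have [||||||s [us [cs us' pms sus subus]]] := @greedy_cycle _ e B j bs.
- by [].
- by rewrite /= size_map sys; nlia.
- by move=> c; rewrite inE => /predU1P[-> //|/mapP[x _ ->]].
- move=> c d /bsA[cA _] /bsA[_ dA]; apply: leq_trans jB _; apply: subset_leq_card.
  by apply/subsetP => u uB; rewrite inE uB eAB //= e_sym eAB.
- rewrite bsf cat_uniq up uys andbT; apply/hasPn => x /subys xA.
  by apply/negP => /dp[]; rewrite xA.
- move=> x; rewrite bsf mem_cat => /orP[/dp[] //|/subys xA].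
  by rewrite (disjointFr dAB xA).
exists s; split => //.
  rewrite (perm_size pms) size_cat sus bsf size_cat /= size_rcons size_map sys.
  by clear -j0; nlia.
move=> x; rewrite (perm_mem pms) mem_cat bsf mem_cat.
by move=> /or3P[/subus/(subsetP sB)|/sub|/subys/(subsetP sA)].
Qed.

(* The path is shortened by bounded even amounts until the biclique can absorb the rest. *)
Lemma flexible_cycle : exists J m0 : nat, forall (T : finType) (e : rel T) m (V0 A B : {set T}) a a' p,
  symmetric e -> m0 <= m -> #|V0| <= 7 * m ->
  (forall x, x \in V0 -> m <= #|[set v in V0 | e x v]|) ->
  #|A| = J -> #|B| = J -> A \subset V0 -> B \subset V0 ->
  path e a' (rcons p a) -> uniq (a' :: rcons p a) -> {subset a' :: rcons p a <= V0} ->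
  (forall x, x \in a' :: rcons p a -> x \notin A /\ x \notin B) -> [disjoint A & B] ->
  (forall x y, x \in a |: (a' |: A) -> y \in B -> e x y) ->
  odd (size p) -> 2 * m <= (size p).+1 -> has_cycle e V0 (2 * m).
Proof.
have [K [d0 HK]] := shorten_path.
(* A single shortening loses at most [K], so a biclique with sides of size [K] can make up for
   overshooting 2m. Once [Z] is set aside, degrees are still at least m - (2K + 2), and the summand
   16K + 16 ensures 7m <= 8(m - (2K + 2)). *)
exists K, (d0 + 16 * K + 16 + K) => T e m V0 A B a a' p e_sym lem leV deg cA cB sA sB.
have [n] := ubnP (size p); elim: n p => // n IH p ltn pe up sub dp dAB eAB op lep.
pose Z := A :|: B :|: [set a; a'].
have cZ : #|Z| <= 2 * K + 2.
  have [+ _] := leq_card_setU (A :|: B) [set a; a'].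
  have [+ _] := leq_card_setU A B.
  have : #|[set a; a']| <= 2 by rewrite cards2; case: (_ != _).
  rewrite -/Z; nlia.
have pZ x : x \in p -> x \in V0 :\: Z.
  move=> xp; have xin : x \in a' :: rcons p a by rewrite inE mem_rcons inE xp !orbT.
  have [xA xB] := dp x xin; rewrite !inE (negbTE xA) (negbTE xB) sub // andbT /=.
  move: up; rewrite /= mem_rcons inE negb_or rcons_uniq => /andP[/andP[_ a'p] /andP[ap _]].
  by apply/norP; split; apply: contraTneq xp => ->.
have [||||||p' [pe' up' sub' szp' op']] :=
  HK T e e_sym (m - (2 * K + 2)) (V0 :\: Z) p a' a _ _ _ pZ.
- by nlia.
- have := subset_leq_card (subsetDl V0 Z); nlia.
- by move: up; rewrite /= rcons_uniq => /and3P[].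
- by rewrite -ltnS; apply: leq_trans lep; nlia.
- move=> x /pZ; rewrite inE => /andP[_ xV]; have := deg x xV.
  have : [set v in V0 | e x v] \subset [set v in V0 :\: Z | e x v] :|: Z.
    by apply/subsetP => v; rewrite !in_setU !inE => /andP[-> ->]; rewrite !andbT orNb.
  move/subset_leq_card; have [+ _] := leq_card_setU [set v in V0 :\: Z | e x v] Z; nlia.
- by [].
have up2 : uniq (a' :: rcons p' a).
  have ap' x : x \in [set a; a'] -> x \notin p'.
    move=> xa; apply/negP => /sub'; rewrite !inE; move: xa; rewrite !inE => ->.
    by rewrite !orbT.
  move: up; rewrite /= !mem_rcons !inE !negb_or !rcons_uniq up' => /andP[/andP[-> _] _] /=.
  by rewrite !ap' // !inE eqxx ?orbT.
have sub2 : {subset a' :: rcons p' a <= V0}.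
  move=> x; rewrite inE mem_rcons inE => /or3P[/eqP->|/eqP->|/sub'].
  - by apply: sub; rewrite mem_head.
  - by apply: sub; rewrite inE mem_rcons mem_head orbT.
  by rewrite inE => /andP[].
have dp2 x : x \in a' :: rcons p' a -> x \notin A /\ x \notin B.
  rewrite inE mem_rcons inE => /or3P[/eqP->|/eqP->|/sub'].
  - by apply: dp; rewrite mem_head.
  - by apply: dp; rewrite inE mem_rcons mem_head orbT.
  by rewrite !inE; case: (x \in A); case: (x \in B).
case/andP: szp' => ltp szp'; have op2 : odd (size p') by rewrite op'.
have [le|lt] := leqP (2 * m) (size p').+1.
  by apply: (IH p') => //; apply: leq_trans ltp _.
have -> : 2 * m = size p' + 1 + 2 * ((2 * m - (size p').+1) %/ 2).
  move: op2 lt; clear; nlia.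
apply: (@biclique_cycle _ e V0 A B a a' p') => //.
- by move: lt op2; clear; nlia.
- by rewrite cA; move: szp' lep; clear; nlia.
- by rewrite cB; move: szp' lep; clear; nlia.
Qed.

(* A special case of the Gould-Haxell-Scott theorem on even cycle lengths in dense graphs. *)
Lemma even_cycle_lengths : exists K m0 : nat, forall (T : finType) (e : rel T) m (V0 : {set T}) s,
  symmetric e -> m0 <= m -> #|V0| <= 7 * m ->
  (forall x, x \in V0 -> m <= #|[set v in V0 | e x v]|) ->
  cycle e s -> uniq s -> {subset s <= V0} -> ~~ odd (size s) -> 2 * m + K <= size s ->
  has_cycle e V0 (2 * m).
Proof.
have [J [m0 HJ]] := flexible_cycle.
(* The three spare vertices are a, a' and, in the second case, one vertex of A that is moved onto
   the path. *)
have [K [d0 HK]] := @bundle_exists (J + 3) (leq_trans (isT : 2 <= 3) (leq_addl _ _)).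
exists (2 * K + 2), (m0 + d0) => T e m V0 s e_sym lem leV deg cs us sub os les.
have pick (A A1 : {set T}) : J + #|A1| <= #|A| ->
    exists A' : {set T}, [/\ A' \subset A, #|A'| = J & [disjoint A' & A1]].
  move=> leA; have [|xs [uxs sxs subxs]] := @take_enum _ (A :\: A1) J.
    have := cardsID A1 A; have := subset_leq_card (subsetIr A A1); nlia.
  exists [set x in xs]; split; last 2 first.
  - by rewrite cardsE -sxs; apply/card_uniqP.
  - by apply/pred0P => x /=; rewrite inE; apply/negP => /andP[/subxs]; rewrite inE => /andP[/negbTE->].
  by apply/subsetP => x; rewrite inE => /subxs; rewrite inE => /andP[].
have rotD r1 a r2 a' r3 : cycle e (r1 ++ a :: r2 ++ a' :: r3) ->
    path e a' (rcons (r3 ++ r1) a).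
  rewrite -cat_cons catA -(rot_cycle (size (r1 ++ a :: r2))) rot_size_cat /=.
  have -> : rcons (r3 ++ r1 ++ a :: r2) a' = (r3 ++ r1) ++ a :: rcons r2 a'.
    by rewrite !rcons_cat rcons_cons catA.
  by rewrite path_cat_cons => /andP[].
have les1 : 2 * m + 2 * K + 2 <= size s by nlia.
have : bundle e (J + 3) K V0 s.
  apply: (HK T e m) => //; try by nlia.
  by move=> x /sub/deg.
clear HK; move=> bs; case: bs cs us sub os les1 => {s les}.
  move=> r1 a r2 a' r3 A B or2 /andP[_ r2K] aA a'A sAr cA cB sBV eAB Boff cs us sub os les.
  have pm : perm_eq (r1 ++ a :: r2 ++ a' :: r3) (r2 ++ a' :: rcons (r3 ++ r1) a).
    apply/permP => f; do 4!rewrite -?cats1 ?count_cat /=; clear; nlia.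
  move: us; rewrite (perm_uniq pm) cat_uniq => /and3P[_ /hasPn dr2 up].
  have [|A' [sA' cA' dA']] := pick A [set a; a'].
    by rewrite cards2; move: cA; case: (_ != _) => /=; clear; nlia.
  have [|B' [sB' cB' _]] := pick B set0.
    by rewrite cards0; move: cB; clear; nlia.
  have Ar2 x : x \in A' -> x \in r2.
    move=> xA'; have := sAr x (subsetP sA' _ xA'); rewrite inE mem_rcons inE.
    by have := disjointFr dA' xA'; rewrite !inE => /norP[/negbTE-> /negbTE->].
  apply: (HJ T e m V0 A' B' a a' (r3 ++ r1)) => //.
  - by apply: leq_trans lem; apply: leq_addr.
  - by apply/subsetP => x /Ar2 xr; apply: sub; rewrite (perm_mem pm) mem_cat xr.
  - by apply: subset_trans sB' sBV.
  - exact: rotD cs.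
  - by move=> x xp; apply: sub; rewrite (perm_mem pm) mem_cat xp orbT.
  - move=> x xp; split; first by apply: contra (dr2 x xp) => /Ar2.
    apply/negP => /(subsetP sB')/Boff; rewrite (perm_mem pm) mem_cat xp orbT //.
  - apply/pred0P => x /=; apply/negP => /andP[/Ar2 xr /(subsetP sB')/Boff].
    by rewrite (perm_mem pm) mem_cat xr.
  - move=> x y; rewrite !inE => /or3P[/eqP->|/eqP->|/(subsetP sA') xA] /(subsetP sB') yB; exact: eAB.
  - move: os or2; rewrite (perm_size pm); do 4!rewrite ?size_cat ?size_rcons /=; clear; nlia.
  move: les r2K; rewrite (perm_size pm); do 4!rewrite ?size_cat ?size_rcons /=; clear; nlia.
move=> r1 a r2 a' u1 b u2 b' u3 A B or2 /andP[_ r2K] aA a'A sAr cA cB ou2 u2K bB b'B sBu eAB cs us sub os les.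
have /card_gt0P[ax] : 0 < #|A :\: [set a; a']|.
  have := cardsID [set a; a'] A; have := subset_leq_card (subsetIr A [set a; a']).
  rewrite cards2; move: cA; case: (_ != _) => /=; clear; nlia.
rewrite !inE negb_or => /andP[/andP[nxa nxa'] axA].
have axr : ax \in r2 by have := sAr ax axA; rewrite inE mem_rcons inE (negbTE nxa) (negbTE nxa').
(* The vertex [ax] of A takes the place of [u2] between b and b'. This frees [u2] for the biclique
   and keeps the parity, [u2] being odd. *)
pose p := u1 ++ b :: ax :: b' :: u3 ++ r1.
pose q := a' :: rcons (u1 ++ b :: b' :: u3 ++ r1) a.
have pm : perm_eq (r1 ++ a :: r2 ++ a' :: u1 ++ b :: u2 ++ b' :: u3) ((r2 ++ u2) ++ q).
  apply/permP => f; rewrite /q; do 6!rewrite -?cats1 ?count_cat /=; clear; nlia.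
have pmp : perm_eq (a' :: rcons p a) (ax :: q).
  apply/permP => f; rewrite /q /p; do 6!rewrite -?cats1 ?count_cat /=; clear; nlia.
have us2 := us; move: us2; rewrite (perm_uniq pm) cat_uniq => /and3P[ur /hasPn dr uq].
have sub2 x : x \in (r2 ++ u2) ++ q -> x \in V0 by rewrite -(perm_mem pm); apply: sub.
have [|A' [sA' cA' dA']] := pick A (ax |: [set a; a']).
  have := cardsU1 ax [set a; a']; rewrite cards2; move: cA.
  by case: (_ \notin _); case: (_ != _) => /=; clear; nlia.
have [|B' [sB' cB' dB']] := pick B [set b; b'].
  by rewrite cards2; move: cB; case: (_ != _) => /=; clear; nlia.
have Ar2 x : x \in A' -> (x \in r2) /\ x != ax.
  move=> xA'; have := sAr x (subsetP sA' _ xA'); rewrite inE mem_rcons inE.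
  by have := disjointFr dA' xA'; rewrite !inE => /norP[-> /norP[/negbTE-> /negbTE->]].
have Bu2 x : x \in B' -> x \in u2.
  move=> xB'; have := sBu x (subsetP sB' _ xB'); rewrite inE mem_rcons inE.
  by have := disjointFr dB' xB'; rewrite !inE => /norP[/negbTE-> /negbTE->].
have dru x : x \in r2 -> x \in u2 -> False.
  by move=> xr xu; move: ur; rewrite cat_uniq => /and3P[_ /hasPn/(_ x xu)]; rewrite /= xr.
have cs2 : path e a' (rcons ((u1 ++ b :: u2 ++ b' :: u3) ++ r1) a) by apply: rotD cs.
apply: (HJ T e m V0 A' B' a a' p) => //.
- by apply: leq_trans lem; apply: leq_addr.
- by apply/subsetP => x /Ar2[xr _]; apply: sub2; rewrite !mem_cat xr.
- by apply/subsetP => x /Bu2 xr; apply: sub2; rewrite !mem_cat xr orbT.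
- move: cs2; rewrite -!catA !rcons_cat /= rcons_cat path_cat_cons => /andP[pb].
  rewrite -catA /= path_cat_cons => /andP[_ pb'].
  by rewrite path_cat_cons pb /= e_sym eAB //= eAB.
- rewrite (perm_uniq pmp) cons_uniq uq andbT; apply: contraL axr => /dr.
  by rewrite mem_cat => /norP[].
- move=> x; rewrite (perm_mem pmp) inE => /predU1P[->|xq]; apply: sub2; rewrite !mem_cat ?axr //.
  by rewrite xq !orbT.
- move=> x; rewrite (perm_mem pmp) inE => /predU1P[->|/dr].
    split; first by apply/negP => /Ar2[_]; rewrite eqxx.
    by apply/negP => /Bu2; apply: dru.
  rewrite mem_cat => /norP[xr xu]; split; [by apply: contra xr => /Ar2[]|by apply: contra xu => /Bu2].
- by apply/pred0P => x /=; apply/negP => /andP[/Ar2[xr _] /Bu2]; apply: dru.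
- move=> x y; rewrite !inE => /or3P[/eqP->|/eqP->|/(subsetP sA') xA] /(subsetP sB') yB; exact: eAB.
- move: os or2 ou2; rewrite (perm_size pm) /p /q; do 4!rewrite ?size_cat ?size_rcons /=; clear; nlia.
move: les r2K u2K; rewrite (perm_size pm) /p /q; do 4!rewrite ?size_cat ?size_rcons /=; clear; nlia.
Qed.

(** * Long paths to a target *)

Section Restrict.
Variables (T : finType) (e : rel T).
Implicit Types S B D : {set T}.
Hypothesis e_sym : symmetric e.

Definition restrict (S : {set T}) : rel T := [rel x y | [&& e x y, x \in S & y \in S]].

Lemma restrictE S x y : restrict S x y = [&& e x y, x \in S & y \in S].
Proof. by []. Qed.

Lemma restrict_path S x p : path (restrict S) x p -> path e x p /\ {subset p <= S}.
Proof.
elim: p x => //= y p IH x /andP[/and3P[-> _ yS] /IH[-> sub]]; split=> // z.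
by rewrite inE => /predU1P[->|/sub].
Qed.

Lemma path_restrict S x p : path e x p -> {subset x :: p <= S} -> path (restrict S) x p.
Proof.
elim: p x => //= y p IH x /andP[exy pe] sub.
rewrite restrictE exy !sub ?inE ?eqxx ?orbT //=; apply: IH => // z zp; apply: sub.
by rewrite inE zp orbT.
Qed.

Lemma connect_restrict_mem S x y : connect (restrict S) x y -> x \in S -> y \in S.
Proof.
case/connectP => p /restrict_path[_ sub] -> xS.
by have := mem_last x p; rewrite inE => /predU1P[->|/sub].
Qed.

Lemma connect_restrict_sym S : connect_sym (restrict S).
Proof. by apply: sym_connect_sym => x y; rewrite !restrictE e_sym [(x \in S) && _]andbC. Qed.

(** The path to z is followed from its last vertex in D onwards. With D a component, this yields an
    edge by which D is left. *)
Lemma last_exit S (D : {set T}) x z : connect (restrict S) x z -> z \notin D ->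
  (x \notin D /\ connect (restrict (S :\: D)) x z) \/
  exists u y, [/\ u \in D, y \in S :\: D, e u y & connect (restrict (S :\: D)) y z].
Proof.
case/connectP => p pp -> {z}; elim: p x pp => [|y p IH] x /=; first by left.
case/andP=> /and3P[exy xS yS] pp zD; have [[yD cyz]|] := IH y pp zD; last by right.
have [xD|xD] := boolP (x \in D); [right | left].
  by exists x, y; rewrite inE yD yS.
split=> //; apply: connect_trans cyz; apply: connect1.
by rewrite restrictE exy !inE xD yD xS yS.
Qed.

Lemma connect_component S v u : connect (restrict S) v u ->
  connect (restrict [set w | connect (restrict S) v w]) v u.
Proof.
set D := [set w | _] => cvu; have vD : v \in D by rewrite inE connect0.
case/connectP: cvu => p pp ->; apply/connectP; exists p => //.
have [pe sub] := restrict_path pp.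
apply: path_restrict => // z zin; rewrite inE.
case/splitPl: zin pp => p1 p2 <-; rewrite cat_path => /andP[p1p _].
by apply/connectP; exists p1.
Qed.

Hypothesis e_irr : irreflexive e.

(* Erdos-Gallai: remove the start x and recurse into a smallest piece cut off by at
   most one further vertex w; the vertices adjacent to w become the new targets. *)
Lemma long_path_to_target (B : {set T}) x (Z : {set T}) lam :
  x \in B -> B :\ x != set0 ->
  (forall v, v \in B -> connect (restrict B) x v) ->
  (forall w v, w \in B -> v \in B :\ w ->
     exists2 z, z \in Z & connect (restrict (B :\ w)) v z) ->
  (forall v, v \in B :\ x -> lam <= #|[set u in B | e v u]| + (v \in Z)) ->
  exists p, [/\ path e x p, uniq (x :: p), {subset x :: p <= B}, last x p \in Z &
    lam <= (size p).+1].
Proof.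
have [n] := ubnP #|B|; elim: n B x Z lam => // n IH B x Z lam ltBn xB /set0Pn[v1 v1H] conB cutB degB.
pose H := B :\ x.
(* The index [None] stands for the components of H, and [Some w] for those components of H without w
   that miss Z; D is a smallest set among all of these. *)
pose Hd (ow : option T) := if ow is Some w then H :\ w else H.
pose comp (i : option T * T) := [set u | connect (restrict (Hd i.1)) i.2 u].
pose P (i : option T * T) := (i.2 \in Hd i.1) &&
  (if i.1 is Some w then (w \in H) && [disjoint comp i & Z] else true).
have P0 : P (None, v1) by rewrite /P /= v1H.
case: (arg_minnP (fun i => #|comp i|) P0) => -[ow v0] /andP[/= v0Hd Pow] minD.
set D := comp (ow, v0) in Pow minD.
have HdH u : u \in Hd ow -> u \in H.
  by case: (ow) => //= w; rewrite !inE => /and3P[_ -> ->].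
have DHd u : u \in D -> u \in Hd ow by rewrite inE => /connect_restrict_mem; apply.
have DH u : u \in D -> u \in H by move/DHd/HdH.
have v0D : v0 \in D by rewrite inE connect0.
have closedD u y : u \in D -> y \in Hd ow -> e u y -> y \in D.
  move=> uD yH euy; rewrite inE; apply: connect_trans (_ : connect _ v0 u) _; first by move: uD; rewrite inE.
  by apply: connect1; rewrite restrictE euy DHd.
have conD u v : u \in D -> v \in D -> connect (restrict D) u v.
  have c0 w : w \in D -> connect (restrict D) v0 w.
    by rewrite inE => /connect_component.
  by move=> /c0 cu /c0 cv; apply: connect_trans cv; rewrite connect_restrict_sym.
have inHd y : y \in H -> Some y != ow -> y \in Hd ow.
  by case: (ow) => //= w yH ny; rewrite in_setD1 yH andbT; apply: contra ny => /eqP->.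
have disD w u : ow = Some w -> u \in D -> u \notin Z.
  by move=> eow uD; move: Pow; rewrite eow => /andP[_ dDZ]; rewrite (disjointFr dDZ).
have HB u : u \in H -> u \in B by rewrite inE => /andP[].
have xH : x \notin H by rewrite !inE eqxx.
(* Otherwise D would be separated from Z by w alone, or, if there is no w, from x. *)
have [x' x'D exx'] : exists2 x', x' \in D & e x x'.
  case eow : ow => [w|].
    have wH : w \in H by move: Pow; rewrite eow => /andP[].
    have v0w : v0 \in B :\ w by move: v0Hd; rewrite eow !inE => /and3P[-> _ ->].
    have [z zZ cz] := cutB w v0 (HB _ wH) v0w.
    have zD : z \notin D by apply: contraTN zZ => /(disD w z eow).
    have [[]|[u [y [uD yB euy _]]]] := last_exit cz zD; first by rewrite v0D.
    exists u => //; rewrite e_sym; have [<- //|nyx] := eqVneq y x.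
    move: yB; rewrite !inE => /andP[yD /andP[nyw yB]]; case/negP: yD.
    have /(closedD u y uD) : y \in Hd ow by rewrite eow /= !inE nyw nyx.
    by rewrite inE; apply.
  have xD : x \notin D by apply: contra xH => /DH.
  have := conB v0 (HB _ (DH _ v0D)); rewrite connect_restrict_sym => cz.
  have [[]|[u [y [uD yB euy _]]]] := last_exit cz xD; first by rewrite v0D.
  exists u => //; rewrite e_sym; have [<- //|nyx] := eqVneq y x.
  move: yB; rewrite !inE => /andP[yD yB]; case/negP: yD.
  have /(closedD u y uD) : y \in Hd ow by rewrite eow /= !inE nyx.
  by rewrite inE; apply.
pose Z' := if ow is Some w then [set u | e u w] else Z.
have target u : u \in D -> exists2 z, z \in Z & connect (restrict H) u z.
  by move=> uD; apply: cutB => //; apply: DH.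
have exitw w u : ow = Some w -> u \in D -> exists u' z, [/\ u' \in D, e u' w, z \in Z &
    connect (restrict (H :\: D)) w z].
  move=> eow uD; have [z zZ cz] := target u uD.
  have zD : z \notin D by apply: contraTN zZ => /(disD w z eow).
  have [[]|[u' [y [u'D yB euy cyz]]]] := last_exit cz zD; first by rewrite uD.
  suff eyw : y = w by exists u', z; rewrite -eyw.
  apply/eqP; apply: contraTT yB => nyw; rewrite in_setD negb_and negbK.
  have [yH|] := boolP (y \in H); last by rewrite orbT.
  by rewrite (closedD u' y) // inHd // eow; apply: contra nyw => /eqP[->].
(* Only x is really lost: a neighbour w outside D is made up for by v belonging to [Z']. *)
have degD v : v \in D -> lam <= #|[set u in D | e v u]| + (v \in Z') + 1.
  move=> vD; have vH := DH v vD; apply: leq_trans (degB v vH) _.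
  have sub : [set u in B | e v u] \subset [set u in D | e v u] :|: ([set x] :|:
      (if ow is Some w then if e v w then [set w] else set0 else set0)).
    apply/subsetP => u; rewrite !inE => /andP[uB evu]; rewrite evu andbT.
    have [//|nux] := eqVneq u x; first by rewrite orbT.
    have uH : u \in H by rewrite !inE nux.
    have [eu|nu] := eqVneq (Some u) ow; first by rewrite -eu evu inE eqxx !orbT.
    have := closedD v u vD (inHd u uH nu) evu; rewrite inE => -> //.
  have := subset_leq_card sub.
  have [+ _] := leq_card_setU [set u in D | e v u] ([set x] :|:
      (if ow is Some w then if e v w then [set w] else set0 else set0)).
  have [+ _] := leq_card_setU [set x]
      (if ow is Some w then if e v w then [set w] else set0 else set0).
  rewrite /Z'; case eow : (ow) => [w|].
    rewrite (negbTE (disD w v eow vD)) inE.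
    by case: (e v w); rewrite ?cards1 ?cards0; clear; nlia.
  by rewrite cards1 cards0; clear; nlia.
have [p' [pp' up' sp' lp' szp']] : exists p', [/\ path e x' p', uniq (x' :: p'),
    {subset x' :: p' <= D}, last x' p' \in Z' & lam <= (size p').+2].
  have [D0|nD0] := eqVneq (D :\ x') set0.
    have Dx' u : u \in D -> u = x'.
      by move=> uD; apply/eqP; have := in_set0 u; rewrite -D0 !inE => /negbT; rewrite negb_and negbK inE in uD *; rewrite uD orbF.
    exists [::]; split => //.
    - by move=> u; rewrite inE => /eqP->.
    - rewrite /= /Z'; case eow : (ow) => [w|].
        by have [u' [z [u'D euw _ _]]] := exitw w x' eow x'D; rewrite inE -(Dx' u' u'D).
      have [z zZ cz] := target x' x'D.
      have zD : z \in D.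
        rewrite inE; apply: connect_trans (_ : connect _ v0 x') _; first by move: x'D; rewrite inE.
        by rewrite eow.
      by rewrite -(Dx' z zD).
    apply: leq_trans (degD x' x'D) _.
    rewrite (_ : [set u in D | e x' u] = set0) ?cards0; first by case: (_ \in _).
    by apply/setP => u; rewrite in_set in_set0; apply/negP => /andP[/Dx'->]; rewrite e_irr.
  have [||||p' [pp' up' sp' lp' szp']] := IH D x' Z' lam.-1 _ x'D nD0.
  - apply: leq_ltn_trans (_ : _ <= #|H|) _; first by apply: subset_leq_card; apply/subsetP.
    by rewrite (cardsD1 x) xB in ltBn.
  - by move=> v vD; apply: conD.
  - move=> w' v w'D vD'; have [vw' vD] : v != w' /\ v \in D by move: vD'; rewrite !inE => /andP[].
    (* If [D2] missed [Z'], it would avoid Z and all neighbours of w, so the piece cut off by [w']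
       would lie inside it and be smaller than D. *)
    pose D2 := [set u | connect (restrict (D :\ w')) v u].
    have [/existsP[z /andP[zD2 zZ']]|no] := boolP [exists z, (z \in D2) && (z \in Z')].
      by exists z => //; move: zD2; rewrite inE.
    have nZ' z : z \in D2 -> z \notin Z'.
      by move=> zD2; apply: contra no => zZ'; apply/existsP; exists z; rewrite zD2.
    have D2D z : z \in D2 -> z \in D :\ w' by rewrite inE => /connect_restrict_mem; apply.
    have sub2 : comp (Some w', v) \subset D2.
      apply/subsetP => u; rewrite inE /= => cu; apply/negPn/negP => uD2.
      have [[]|[u' [y [u'D2 yB euy _]]]] := last_exit cu uD2; first by rewrite inE connect0.
      have [_ u'D] := setD1P (D2D u' u'D2).
      move: yB; rewrite in_setD => /andP[yD2]; rewrite in_setD1 => /andP[yw' yH].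
      have yD : y \notin D.
        apply: contra yD2 => yD; rewrite inE; apply: connect_trans (_ : connect _ v u') _.
          by move: u'D2; rewrite inE.
        by apply: connect1; rewrite restrictE euy D2D //= in_setD1 yw'.
      have eyow : Some y = ow by apply/eqP; apply: contraNT yD => ny; apply: closedD (inHd y yH ny) euy.
      by have := nZ' u' u'D2; rewrite /Z' -eyow inE euy.
    have Pw' : P (Some w', v).
      rewrite /P /= in_setD1 vw' (DH v vD) (DH w' w'D) /=.
      apply/pred0P => z /=; apply/negP => /andP[/(subsetP sub2) zD2 zZ].
      have [_ zD] := setD1P (D2D z zD2); have := nZ' z zD2; rewrite /Z'.
      by case eow : (ow) => [w|]; [have := disD w z eow zD|]; rewrite zZ.
    have := minD _ Pw'; rewrite leqNgt => /negP[]; apply: leq_ltn_trans (subset_leq_card sub2) _.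
    apply: leq_ltn_trans (_ : _ <= #|D :\ w'|) _.
      by apply: subset_leq_card; apply/subsetP.
    by rewrite (cardsD1 w' D) w'D.
  - move=> v; rewrite in_setD1 => /andP[_ vD]; have := degD v vD; nlia.
  by exists p'; split => //; move: szp'; clear; case: lam.
have xD : x \notin D by apply: contra xH => /DH.
have xp' : x \notin x' :: p' by apply: contra xD => /sp'.
case eow : ow => [w|]; last first.
  exists (x' :: p'); split.
  - by rewrite /= exx'.
  - by rewrite cons_uniq xp'.
  - by move=> u; rewrite inE => /predU1P[->//|/sp'/DH/HB].
  - by move: lp'; rewrite /Z' eow.
  by [].
have [u' [z [_ _ zZ cwz]]] := exitw w x' eow x'D.
have wH : w \in H by move: Pow; rewrite eow => /andP[].
have wD : w \notin D by apply/negP => /DHd; rewrite eow !inE eqxx.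
case/connectP: cwz => q0 /shortenP[q pq uq _] def_z; have [peq subq] := restrict_path pq.
have subwq u : u \in w :: q -> u \in H :\: D.
  by rewrite inE => /predU1P[->|/subq //]; rewrite inE wD.
exists (x' :: p' ++ w :: q); split.
- rewrite /= exx' cat_path pp' /= peq andbT.
  by move: lp'; rewrite /Z' eow inE.
- have uq2 : uniq ((x' :: p') ++ w :: q).
    rewrite cat_uniq up' uq andbT; apply/hasPn => u /subwq; rewrite inE => /andP[uD _].
    by apply: contra uD => /sp'.
  apply/andP; split; last exact: uq2.
  rewrite -cat_cons mem_cat (negbTE xp') /=.
  by apply: contra xH => /subwq; rewrite inE => /andP[].
- move=> u; rewrite inE -cat_cons mem_cat => /or3P[/eqP->//|/sp'/DH/HB//|/subwq].
  by rewrite inE => /andP[_ /HB].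
- by rewrite /= last_cat /= -def_z.
by apply: leq_trans szp' _; rewrite /= size_cat; clear; nlia.
Qed.

End Restrict.

(** * Odd Hamiltonian cycles *)

Lemma sum_shift (g : nat -> nat) q c : (forall i, g (i + q) = g i) ->
  \sum_(u < q) g (u + c) = \sum_(u < q) g u.
Proof.
move=> gq; elim: c => [|c <-]; first by apply: eq_bigr => u _; rewrite addn0.
case: q gq => [|q] gq; first by rewrite !big_ord0.
rewrite big_ord_recr [RHS]big_ord_recl /= [LHS]addnC add0n; congr (_ + _).
  by rewrite -(gq c); congr g; nlia.
by apply: eq_bigr => u _; rewrite addSnnS.
Qed.

Lemma cycle_nth (T : Type) (e : rel T) (s : seq T) x0 i : cycle e s -> 0 < size s ->
  e (nth x0 s (i %% size s)) (nth x0 s (i.+1 %% size s)).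
Proof.
move=> cs; set q := size s => q0.
have /(pathP x0) pe : path e (last x0 s) s by rewrite -cycle_path.
have lti : i %% q < q by rewrite ltn_mod.
have ei : i.+1 %% q = (i %% q).+1 %% q by rewrite -addn1 -modnDml addn1.
have [lt|ge] := ltnP (i %% q).+1 q; first by have := pe _ lt; rewrite ei (modn_small lt).
have e1 : (i %% q).+1 = q by apply/eqP; rewrite eqn_leq lti ge.
have e2 : last x0 s = nth x0 s (i %% q) by rewrite -nth_last -[X in X.-1]e1.
by have := pe 0 q0; rewrite ei e1 modnn /= e2.
Qed.

Section OddCycle.
Variables (T : finType) (e : rel T).
Hypotheses (e_sym : symmetric e) (e_irr : irreflexive e).
Variables (s : seq T) (x0 : T) (h : nat).
Hypotheses (cs : cycle e s) (us : uniq s) (os : odd (size s)) (les : 2 * h <= size s).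
Hypothesis deg : forall x, x \in s -> h < #|[set y in s | e x y]|.
Hypothesis noeven : forall c, cycle e c -> uniq c -> {subset c <= s} ->
  ~~ odd (size c) -> size c < 2 * h.

Let q := size s.
Let f i := nth x0 s (i %% q).
Let q_gt0 : 0 < q. Proof. by rewrite lt0n; apply: contraTneq os; rewrite /q => ->. Qed.

Let fq i : f (i + q) = f i. Proof. by rewrite /f modnDr. Qed.

Let f_mem i : f i \in s. Proof. by rewrite mem_nth // ltn_mod. Qed.

Let f_inj w i j : w <= i < w + q -> w <= j < w + q -> f i = f j -> i = j.
Proof.
wlog le_ij : i j / i <= j => [W wi wj fij|wi wj].
  by have [le|/ltnW le] := leqP i j; [exact: W | apply/esym/W].
move/eqP; rewrite nth_uniq ?ltn_mod // eq_sym eqn_mod_dvd // => dv.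
have : j - i < q by move: wi wj; nlia.
by move: dv => /dvdnP[[|k] dk]; rewrite ?mulSn in dk; nlia.
Qed.

Let f_edge i : e (f i) (f i.+1). Proof. exact: cycle_nth. Qed.

Let seg w k := [seq f i | i <- iota w k].

Let seg_path w k : path e (f w) (seg w.+1 k).
Proof. by elim: k w => //= k IH w; rewrite f_edge IH. Qed.

Let last_seg w k : last (f w) (seg w.+1 k) = f (w + k).
Proof. by elim: k w => [|k IH] w /=; rewrite ?addn0 // IH addSnnS. Qed.

Let seg_sub w k : {subset seg w k <= s}.
Proof. by move=> x /mapP[i _ ->]. Qed.

Let seg_uniq w k : k <= q -> uniq (seg w k).
Proof.
move=> lek; rewrite map_inj_in_uniq ?iota_uniq // => i j.
by rewrite !mem_iota => hi hj; apply: (@f_inj w); move: hi hj; nlia.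
Qed.

Let short_chord u r : odd r -> r < q -> e (f u) (f (u + r)) -> r.+1 < 2 * h.
Proof.
move=> or ltr eur; have sz : size (f u :: seg u.+1 r) = r.+1 by rewrite /= size_map size_iota.
rewrite -sz; apply: noeven.
- by rewrite /= rcons_path seg_path last_seg e_sym eur.
- exact: (@seg_uniq u r.+1).
- exact: (@seg_sub u r.+1).
- by rewrite sz /= or.
Qed.

(* The chords from u forward by r and from u+1 backward by t cross. *)
Let crossing u r t : r + t = 2 * h -> 0 < r -> 0 < t ->
  e (f u) (f (u + r)) -> e (f (u.+1 + q - t)) (f u.+1) -> False.
Proof.
move=> rt r0 t0 e1 e2; pose v := u.+1 + q - t.
pose c := (f v :: seg v.+1 t.-1) ++ rev (f u.+1 :: seg u.+2 r.-1).
have ltq : r + t <= q by rewrite rt.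
have lB : last (f v) (seg v.+1 t.-1) = f u.
  by rewrite last_seg -(fq u); congr f; rewrite /v; nlia.
have sz : size c = 2 * h by rewrite size_cat size_rev /= !size_map !size_iota; nlia.
suff : size c < 2 * h by rewrite sz ltnn.
have segE w k : 0 < k -> f w :: seg w.+1 k.-1 = seg w k by case: k.
apply: noeven.
- rewrite /c /= rcons_cat cat_path seg_path lB /= -cats1 path_rev_cat //= last_seg.
  rewrite addSnnS prednK // e1 seg_path /= andbT e_sym; exact: e2.
- rewrite /c !segE // cat_uniq rev_uniq !seg_uniq ?andbT //=; try nlia.
  apply/hasPn => x; rewrite mem_rev => /mapP[i]; rewrite mem_iota => hi ->.
  apply/negP => /mapP[j]; rewrite mem_iota => hj /(@f_inj u.+1) h'.
  have vE : v + t = u.+1 + q by rewrite /v; nlia.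
  have wi : u.+1 <= i < u.+1 + q by move: hi; nlia.
  have wj : u.+1 <= j < u.+1 + q by move: hj; nlia.
  by have := h' wi wj; move: hi hj; nlia.
- by move=> x; rewrite mem_cat mem_rev !segE // => /orP[]/seg_sub.
by rewrite sz oddM.
Qed.

(** The number of positions u on the cycle from which the forward jump by r is an edge. *)
Let A r := \sum_(u < q) e (f u) (f (u + r)).

(** After a cyclic shift of the second sum, position u is charged with the two chords of [crossing],
    which do not both exist. *)
Let A_le2 r t : odd r -> r + t = 2 * h -> A r + A t <= q.
Proof.
move=> or rt; have ot : odd t by have := congr1 odd rt; rewrite oddD or oddM; case: (odd t).
have r0 : 0 < r by case: (r) or. have t0 : 0 < t by case: (t) ot.
have ltq : r + t <= q by rewrite rt.
have -> : A t = \sum_(u < q) e (f (u + (1 + q - t))) (f (u + (1 + q - t) + t)).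
  by rewrite (@sum_shift (fun u => nat_of_bool (e (f u) (f (u + t))))) // => i; rewrite addnAC !fq.
rewrite /A -big_split /=; apply: leq_trans (_ : \sum_(u < q) 1 <= q); last by rewrite sum1_card card_ord.
apply: leq_sum => u _; have [e1|_] := boolP (e (f u) (f (u + r))); last by rewrite add0n leq_b1.
rewrite (_ : u + (1 + q - t) = u.+1 + q - t); last by nlia.
rewrite (_ : u.+1 + q - t + t = u.+1 + q); last by nlia.
rewrite fq; have [e2|//] := boolP (e _ _).
by case: (crossing rt r0 t0 e1 e2).
Qed.

Let A_sym r : r <= q -> A (q - r) = A r.
Proof.
move=> ler; rewrite /A -(@sum_shift (fun u => nat_of_bool (e (f u) (f (u + (q - r))))) q r).
  by apply: eq_bigr => u _; rewrite -addnA subnKC // fq e_sym.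
by move=> i; rewrite addnAC !fq.
Qed.

Let A_long r : odd r -> 2 * h <= r.+1 -> r < q -> A r = 0.
Proof.
move=> or le lt; apply: big1 => u _; have [e1|//] := boolP (e _ _).
by have := short_chord or lt e1; nlia.
Qed.

Let deg_sum : q * h.+1 <= \sum_(r < q) A r.
Proof.
rewrite exchange_big /= -[q in q * _]card_ord -sum_nat_const; apply: leq_sum => u _.
apply: leq_trans (deg (f_mem u)) _.
pose g (r : 'I_q) := f (u + r).
have gi : injective g.
  move=> i j /(@f_inj u) gij; apply: val_inj => /=; have := ltn_ord i; have := ltn_ord j.
  by move=> lj li; have := gij; rewrite !leq_addr !ltn_add2l lj li => /(_ isT isT)/addnI.
rewrite -sum1_card big_mkcond /=.
have -> : \sum_(r < q) e (f u) (f (u + r)) = #|[set g r | r in [pred r : 'I_q | e (f u) (g r)]]|.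
  by rewrite card_imset // -sum1_card [RHS]big_mkcond; apply: eq_bigr => r _; rewrite !inE; case: (e _ _).
rewrite -big_mkcond sum1_card; apply: subset_leq_card; apply/subsetP => y; rewrite inE => /andP[ys euy].
have lt : (index y s + (q - u)) %% q < q by rewrite ltn_mod.
have gy : g (Ordinal lt) = y.
  rewrite /g /= /f modnDmr addnCA subnKC; last exact: ltnW.
  by rewrite modnDr modn_small ?index_mem // nth_index.
by apply/imsetP; exists (Ordinal lt) => //; rewrite inE gy.
Qed.

(** As q is odd, [A_sym] exchanges even and odd distances, so only odd ones need be counted, twice.
    Those beyond 2h vanish, and the others pair off as r and 2h - r with at most q edges per pair.
    The total is at most hq, but the degrees force q(h + 1). *)
Lemma odd_cycle_contradiction : False.
Proof.
have A0 : A 0 = 0 by apply: big1 => u _; rewrite addn0 e_irr.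
have odd_sum p : \sum_(r < p.*2.+1) A r = A 0 + (\sum_(i < p) A i.*2.+1 + \sum_(i < p) A i.*2.+2).
  elim: p => [|p IH]; first by rewrite !big_ord0 big_ord_recr big_ord0 /= addnC.
  by rewrite doubleS !big_ord_recr /= in IH *; rewrite IH; clear; nlia.
have qE : q = q./2.*2.+1 by rewrite -[LHS]odd_double_half os.
have hp : h <= q./2 by have := les; rewrite -/q; nlia.
have S1 : \sum_(r < q) A r <= 2 * \sum_(i < h) A i.*2.+1.
  have sq : \sum_(r < q) A r = \sum_(r < q./2.*2.+1) A r := congr1 (fun n => \sum_(r < n) A r) qE.
  rewrite sq odd_sum A0 add0n.
  have -> : \sum_(i < q./2) A i.*2.+2 = \sum_(i < q./2) A i.*2.+1.
    rewrite (reindex_inj rev_ord_inj) /=; apply: eq_bigr => i _.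
    have li := ltn_ord i; rewrite -[RHS]A_sym; last by nlia.
    by congr A; nlia.
  rewrite mul2n addnn leq_double -(subnKC hp) big_split_ord /= [X in _ + X]big1 ?addn0 //.
  by move=> i _; have li := ltn_ord i; apply: A_long => /=; rewrite ?odd_double //; nlia.
have S2 : 2 * \sum_(i < h) A i.*2.+1 <= h * q.
  rewrite mul2n -addnn {2}(reindex_inj rev_ord_inj) /= -big_split /=.
  rewrite -[h in h * q]card_ord -sum_nat_const; apply: leq_sum => i _.
  by have li := ltn_ord i; apply: A_le2; rewrite /= ?odd_double //; nlia.
have := leq_trans deg_sum (leq_trans S1 S2); rewrite mulnS mulnC.
by rewrite -[X in _ <= X]add0n leq_add2r leqNgt q_gt0.
Qed.

End OddCycle.

(** * Long even cycles in 3-connected graphs *)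

Lemma path_spread i s : path (fun a b => a + 2 <= b) i s -> i + 2 * size s <= last i s.
Proof. by elim: s i => [|b s IH] i /=; [rewrite muln0 addn0 | case/andP => ib /IH; nlia]. Qed.

(** Somewhere P changes from true to false between consecutive entries; this one step accounts for
    G, all others for at least 2. *)
Lemma path_spread_jump (P : pred nat) G i s : path (fun a b => a + 2 <= b) i s ->
  (forall a b, a \in i :: s -> b \in i :: s -> a < b -> P a -> ~~ P b -> a + G <= b) ->
  P i -> ~~ P (last i s) -> i + 2 * (size s).-1 + G <= last i s.
Proof.
elim: s i => [|b s IH] i /=; first by move=> _ _ ->.
case/andP=> ib ps jump Pi nPl; have [Pb|nPb] := boolP (P b).
  have s0 : 0 < size s by case: (s) nPl => //=; rewrite Pb.
  have jump' a c : a \in b :: s -> c \in b :: s -> a < c -> P a -> ~~ P c -> a + G <= c.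
    by move=> ain cin; apply: jump; rewrite inE ?ain ?cin orbT.
  have := IH b ps jump' Pb nPl; nlia.
have ltib : i < b by nlia.
have := jump i b (mem_head _ _) _ ltib Pi nPb; rewrite !inE eqxx orbT => /(_ isT).
have := path_spread ps; nlia.
Qed.

(** Here q is the length of the cycle, l the number of vertices of the detour, which ends next to
    position 0, and the list gives the attachments of its start. If q < 2h, spacing by 2 suffices.
    Otherwise q is odd, and each attachment makes exactly one of its two detour cycles even. If the
    last attachment has its even cycle along the initial arc, or the first one along the final arc,
    that cycle spans all attachments and bounds their number. Otherwise the parity changes between
    two neighbouring attachments; the cycle bypassing the gap there is even, so the gap is at least
    q + 4 - 2h. *)
Lemma gap_count q l h i s : path (fun a b => a + 2 <= b) i s ->
  (forall a, a \in i :: s -> [/\ l < a, a + l < q,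
     ~~ odd (a + 1 + l) -> a + 1 + l < 2 * h & ~~ odd (q - a + 1 + l) -> q - a + 1 + l < 2 * h]) ->
  (forall a b, a \in i :: s -> b \in i :: s -> a < b -> ~~ odd (a + 2 + (q - b)) -> a + 2 + (q - b) < 2 * h) ->
  (~~ odd q -> q < 2 * h) -> (size s).+1 + l < h.
Proof.
move=> ps one two evq.
have [li _ _ evi] := one i (mem_head _ _).
have [_ lL evL _] := one (last i s) (mem_last _ _).
have sp := path_spread ps.
have [lt|le] := ltnP q (2 * h); first by nlia.
have oq : odd q by apply: contraTT le => /evq; rewrite -ltnNge.
have [PL|nPL] := boolP (~~ odd (last i s + 1 + l)).
  by have := evL PL; move: PL; clear -sp li; nlia.
have [Pi|nPi] := boolP (~~ odd (i + 1 + l)); last first.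
  have ev : ~~ odd (q - i + 1 + l) by move: oq nPi; clear -sp lL; nlia.
  by have := evi ev; move: ev; nlia.
have := @path_spread_jump (fun a => ~~ odd (a + 1 + l)) (q + 4 - 2 * h) i s ps _ Pi nPL.
have s0 : 0 < size s by case: (s) nPL => //=; rewrite Pi.
move=> H; suff {H} /H : forall a b, a \in i :: s -> b \in i :: s -> a < b ->
  ~~ odd (a + 1 + l) -> ~~ ~~ odd (b + 1 + l) -> a + (q + 4 - 2 * h) <= b by nlia.
move=> a b ai bi ltab oa ob; have := two a b ai bi ltab.
have [_ lb _ _] := one b bi.
have ev : ~~ odd (a + 2 + (q - b)) by move: oa ob oq; clear -ltab lb; nlia.
by move=> /(_ ev); move: ev; clear -ltab lb le; nlia.
Qed.

Section LongEvenCycle.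
Variables (T : finType) (e : rel T).
Hypotheses (e_sym : symmetric e) (e_irr : irreflexive e).

Lemma detour_cycle (p0 : T) (s : seq T) y p a :
  cycle e (p0 :: s) -> uniq (p0 :: s) -> path e y p -> uniq (y :: p) ->
  (forall x, x \in y :: p -> x \notin p0 :: s) -> e (last y p) p0 ->
  a <= size s -> e y (nth p0 (p0 :: s) a) ->
  exists c, [/\ cycle e c, uniq c, size c = a + 1 + (size p).+1 &
    forall x, x \in c -> (x \in p0 :: s) || (x \in y :: p)].
Proof.
move=> cs us pp up dsp elp lea eya.
have ss : subseq (p0 :: take a s) (p0 :: s).
  by rewrite -[X in subseq _ (_ :: X)](cat_take_drop a) -cat_cons prefix_subseq.
exists ((p0 :: take a s) ++ y :: p); split.
- move: cs; rewrite /= -{1}(cat_take_drop a s) rcons_cat cat_path => /andP[pt _].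
  by rewrite rcons_cat cat_path pt (@last_take _ p0) //= e_sym eya rcons_path pp elp.
- rewrite cat_uniq (subseq_uniq ss us) up andbT; apply/hasPn => x /dsp.
  by apply: contra; apply: mem_subseq.
- by rewrite size_cat /= size_takel // addn1.
by move=> x; rewrite mem_cat => /orP[/(mem_subseq ss)->|->]; rewrite ?orbT.
Qed.

Lemma bypass_cycle (p0 : T) (s : seq T) y a b :
  cycle e (p0 :: s) -> uniq (p0 :: s) -> y \notin p0 :: s -> a < b -> b <= size s ->
  e y (nth p0 (p0 :: s) a) -> e y (nth p0 (p0 :: s) b) ->
  exists c, [/\ cycle e c, uniq c, size c = a + 2 + ((size s).+1 - b) &
    forall x, x \in c -> (x \in p0 :: s) || (x == y)].
Proof.
case: b => // b cs us ys ltab leb eya /= eyb.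
have ss : subseq ((p0 :: take a s) ++ drop b s) (p0 :: s).
  rewrite -[X in subseq _ (_ :: X)](cat_take_drop b) -cat_cons cat_subseq //.
  by rewrite /= eqxx -[X in subseq X _](@take_takel _ a b) // -{2}(cat_take_drop a (take b s)) prefix_subseq.
have pm : perm_eq ((p0 :: take a s) ++ y :: drop b s) (y :: (p0 :: take a s) ++ drop b s).
  by rewrite -[y :: drop b s]cat1s perm_catCA.
have lea : a <= size s by nlia.
exists ((p0 :: take a s) ++ y :: drop b s); split.
- have pt : path e p0 (take a s).
    by move: cs; rewrite /= -{1}(cat_take_drop a s) rcons_cat cat_path => /andP[].
  move: cs; rewrite /= -{1}(cat_take_drop b s) rcons_cat cat_path => /andP[_].
  rewrite (drop_nth p0) //= => /andP[_ pd].
  by rewrite rcons_cat cat_path pt (@last_take _ p0) //= e_sym eya /= eyb pd.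
- rewrite (perm_uniq pm) cons_uniq (subseq_uniq ss us) andbT.
  by apply: contra ys; apply: mem_subseq.
- by rewrite (perm_size pm) /= size_cat size_takel // size_drop; nlia.
by move=> x; rewrite (perm_mem pm) inE => /predU1P[->|/(mem_subseq ss)->]; rewrite ?eqxx ?orbT.
Qed.

(* A path from y to p0 runs outside a longest cycle through p0.  The gaps between the
   neighbours of y on the cycle are long, and so is every gap at which a detour would
   change the parity. *)
Lemma detour_count (W : {set T}) (p0 : T) (s : seq T) y p h :
  cycle e (p0 :: s) -> uniq (p0 :: s) -> {subset p0 :: s <= W} ->
  (forall c, cycle e c -> uniq c -> {subset c <= W} -> size c <= (size s).+1) ->
  (forall c, cycle e c -> uniq c -> {subset c <= W} -> ~~ odd (size c) -> size c < 2 * h) ->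
  path e y p -> uniq (y :: p) -> {subset y :: p <= W} ->
  (forall x, x \in y :: p -> x \notin p0 :: s) -> e (last y p) p0 ->
  has (e y) s -> count (e y) s + (size p).+1 < h.
Proof.
move=> cs us subs longest noeven pp up subp dsp elp hs.
pose f := nth p0 (p0 :: s).
have subW x : (x \in p0 :: s) || (x \in y :: p) -> x \in W by case/orP=> [/subs|/subp].
pose I := [seq a <- iota 1 (size s) | e y (f a)].
have sI : size I = count (e y) s.
  rewrite size_filter -[in RHS](mkseq_nth p0 s) /mkseq count_map.
  by rewrite -[1]addn0 iotaDl count_map; apply: eq_count => a.
have memI a : a \in I -> [/\ 0 < a, a <= size s & e y (f a)].
  by rewrite mem_filter mem_iota add1n ltnS => /and3P[].
have two a b : a \in I -> b \in I -> a < b -> exists c, [/\ cycle e c, uniq c,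
    size c = a + 2 + ((size s).+1 - b) & {subset c <= W}].
  move=> /memI[_ _ ea] /memI[_ leb eb] ltab.
  have yn : y \notin p0 :: s by apply: dsp; rewrite mem_head.
  have [c [cc uc sc subc]] := bypass_cycle cs us yn ltab leb ea eb.
  exists c; split => // x /subc /orP[xs|/eqP->]; apply: subW; rewrite ?xs //.
  by rewrite mem_head orbT.
(* The detour the other way round is read off the reversed cycle, where position a becomes |s| + 1 -
   a. *)
have csr : cycle e (p0 :: rev s).
  rewrite -(rot_cycle 1) rot1_cons -rev_cons rev_cycle.
  by rewrite (eq_cycle (e' := e)) // => u v; rewrite e_sym.
have pmr : perm_eq (p0 :: rev s) (p0 :: s) by rewrite perm_cons perm_rev.
have usr : uniq (p0 :: rev s) by rewrite (perm_uniq pmr).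
have one a : a \in I -> exists c c', [/\ cycle e c /\ cycle e c', uniq c /\ uniq c',
    size c = a + 1 + (size p).+1, size c' = (size s).+1 - a + 1 + (size p).+1 &
    {subset c <= W} /\ {subset c' <= W}].
  move=> /memI[a0 lea ea].
  have [c [cc uc sc subc]] := detour_cycle cs us pp up dsp elp lea ea.
  have [|||c' [cc' uc' sc' subc']] := @detour_cycle p0 (rev s) y p ((size s).+1 - a) csr usr pp up _ elp.
  - by move=> x /dsp; rewrite (perm_mem pmr).
  - by rewrite size_rev; nlia.
  - rewrite (_ : (size s).+1 - a = (size s - a).+1); last by nlia.
    rewrite /= nth_rev; last by nlia.
    rewrite (_ : size s - (size s - a).+1 = a.-1); last by nlia.
    by move: ea; rewrite /f; case: (a) a0.
  exists c, c'; split => //; split => x; first by move/subc/subW.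
  by move/subc'; rewrite (perm_mem pmr) => /subW.
have srt : sorted ltn I by apply: sorted_filter; [exact: ltn_trans | exact: iota_ltn_sorted].
move: hs; rewrite has_count -sI; case defI : I srt => [//|i t] /= srt _.
apply: (@gap_count (size s).+1 _ h i t).
- apply: (@sub_in_path _ [in I] ltn) srt; last by rewrite -defI; apply/allP.
  move=> a b aI bI ltab; have [c [cc uc sc subc]] := two a b aI bI ltab.
  have [_ leb _] := memI b bI; have := longest c cc uc subc; nlia.
- move=> a; rewrite -defI => aI; have [c [c' [[cc cc'] [uc uc'] sc sc' [sub sub']]]] := one a aI.
  have [a0 lea _] := memI a aI.
  have l1 := longest c cc uc sub; have l2 := longest c' cc' uc' sub'.
  split; [nlia | nlia | rewrite -sc | rewrite -sc']; exact: noeven.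
- move=> a b; rewrite -defI => aI bI ltab; have [c [cc uc sc subc]] := two a b aI bI ltab.
  by rewrite -sc; apply: noeven.
by move=> os; apply: (noeven (p0 :: s)).
Qed.

(** A longest cycle that misses part of W is attached to a component D outside it. The detour starts
    at the vertex of D with the most neighbours on the cycle, so that whatever degree the other
    vertices of D lack on the cycle they have inside D. Attachments and detour together then exceed
    what [detour_count] permits. *)
Lemma long_even_cycle (W : {set T}) h :
  0 < h -> 2 * h <= #|W| -> (forall x, x \in W -> h < #|[set y in W | e x y]|) ->
  (forall (S : {set T}) u v, #|S| <= 2 -> u \in W :\: S -> v \in W :\: S -> connect (restrict e (W :\: S)) u v) ->
  exists2 k, ~~ odd k & 2 * h <= k /\ has_cycle e W k.
Proof.
move=> h0 leW deg con.
pose b k := [exists t : k.-tuple T, [&& cycle e t, uniq t & [set x in t] \subset W]].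
have bP k : reflect (has_cycle e W k) (b k) by apply: has_cycleP.
have bound k : b k -> k <= #|T|.
  by move=> /bP[s [_ us <- _]]; rewrite -(card_uniqP us) max_card.
have [/existsP[k /and3P[ek lek /bP ck]]|no] :=
  boolP [exists k : 'I_#|T|.+1, [&& ~~ odd k, 2 * h <= k & b k]].
  by exists k.
have noeven c : cycle e c -> uniq c -> {subset c <= W} -> ~~ odd (size c) -> size c < 2 * h.
  move=> cc uc subc ec; rewrite ltnNge; apply: contra no => le.
  have bc : b (size c) by apply/bP; exists c.
  by apply/existsP; exists (inord (size c)); rewrite inordK ?ltnS ?bound // ec le bc.
have [w wW] : exists w, w \in W by apply/card_gt0P; nlia.
(* For [has_cycle] a single edge counts as a cycle of length 2, which guarantees that a longest
   cycle exists. *)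
have b2 : b 2.
  have /card_gt0P[w'] : 0 < #|[set y in W | e w y]| by apply: leq_trans (deg w wW).
  rewrite inE => /andP[w'W ww']; apply/bP; exists [:: w; w']; split => //.
  - by rewrite /= ww' e_sym ww'.
  - by rewrite /= inE andbT; apply: contraTneq ww' => ->; rewrite e_irr.
  by move=> x; rewrite !inE => /orP[]/eqP->.
case: (ex_maxnP (ex_intro _ 2 b2) bound) => q /bP[s [cs us ss subs]] maxq.
have longest c : cycle e c -> uniq c -> {subset c <= W} -> size c <= size s.
  by move=> cc uc subc; rewrite ss; apply: maxq; apply/bP; exists c.
have q2 : 1 < size s by rewrite ss; apply: maxq.
pose OS := [set x in s].
have cOS : #|OS| = size s by rewrite cardsE; apply/card_uniqP.
have OSW : OS \subset W by apply/subsetP => x; rewrite inE => /subs.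
have [WO|] := boolP (W \subset OS).
  have eW : W = OS by apply/eqP; rewrite eqEsubset WO OSW.
  have les : 2 * h <= size s by rewrite -cOS -eW.
  have os : odd (size s) by apply: contraTT les => /(noeven s cs us subs); rewrite -ltnNge.
  case: (@odd_cycle_contradiction T e e_sym e_irr s w h cs us os les).
    by move=> x /subs xW; apply: leq_trans (deg x xW) _; rewrite eW; apply: subset_leq_card; apply/subsetP => z; rewrite !inE.
  by move=> c cc uc subc; apply: noeven => // z /subc/subs.
case/subsetPn => y yW yO; pose U := W :\: OS; pose D := [set v | connect (restrict e U) y v].
have yU : y \in U by rewrite in_setD yO.
have DU v : v \in D -> v \in U by rewrite inE => /connect_restrict_mem; apply.
have yD : y \in D by rewrite inE connect0.
have closedD u v : u \in D -> v \in U -> e u v -> v \in D.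
  move=> uD vU euv; rewrite inE; apply: connect_trans (_ : connect _ y u) _; first by move: uD; rewrite inE.
  by apply: connect1; rewrite restrictE euv DU.
pose dO v := #|[set o in OS | e v o]|.
have [y0 y0D' maxd] := arg_maxnP dO yD; have y0D : y0 \in D by [].
have degD v : v \in D -> h < #|[set u in D | e v u]| + dO v.
  move=> vD; have := DU v vD; rewrite inE => /andP[_ vW]; apply: leq_trans (deg v vW) _.
  apply: leq_trans (leq_card_setU _ _).1; apply: subset_leq_card; apply/subsetP => u.
  rewrite !in_setU !in_set => /andP[uW evu]; rewrite evu !andbT.
  have [//|uO] := boolP (u \in s); first by rewrite orbT.
  by have := closedD v u vD _ evu; rewrite !inE uO uW orbF; apply.
have d0 : 0 < dO y0.
  have /card_gt0P[o oO] : 0 < #|OS| by rewrite cOS; apply: ltnW.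
  have oD : o \notin D by apply: contraL oO => /DU; rewrite inE => /andP[].
  have := con set0 y o; rewrite cards0 !setD0 => /(_ isT yW (subsetP OSW o oO)) cyo.
  have [[]|[u [v [uD vW euv _]]]] := last_exit cyo oD; first by rewrite yD.
  apply: leq_trans (maxd u uD); apply/card_gt0P; exists v; rewrite in_set euv andbT.
  by apply: contraLR vW => vO; rewrite in_setD negb_and negbK; have [vW|] := boolP (v \in W);
    rewrite ?orbT // (closedD u v) // in_setD vO.
have /card_gt0P[p] := d0; rewrite in_set => /andP[pO ey0p].
have [pi [p' [ppi upi subpi elp [p'O leh]]]] : exists pi p', [/\ path e y0 pi, uniq (y0 :: pi),
    {subset y0 :: pi <= D}, e (last y0 pi) p' & p' \in OS :\ p /\ h < dO y0 + (size pi).+1].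
  have [D0|nD0] := eqVneq (D :\ y0) set0.
    have := degD y0 y0D; rewrite (_ : [set u in D | e y0 u] = set0) ?cards0; last first.
      apply/eqP; rewrite -subset0; apply/subsetP => u; rewrite in_set => /andP[uD eu].
      rewrite -D0 in_setD1 uD andbT; apply: contraTneq eu => ->; by rewrite e_irr.
    rewrite add0n => hd; have /card_gt0P[p'] : 0 < #|[set o in OS | e y0 o] :\ p|.
      by have := cardsD1 p [set o in OS | e y0 o]; rewrite in_set pO ey0p -/(dO y0); nlia.
    rewrite in_setD1 in_set => /and3P[np p'O ep']; exists [::], p'; split => //.
    + by move=> x; rewrite inE => /eqP->.
    by rewrite in_setD1 np p'O addn1; split => //; apply: ltnW.
  (* The targets ignore p, so the detour ends at some p' distinct from p, and p remains as an
     attachment of [y0]. That every target is reachable after deleting a vertex x of D is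
     connectivity without x and p. *)
  have [|||pi [ppi upi subpi + leh]] := @long_path_to_target T e e_sym e_irr D y0
    [set v | [exists o in OS :\ p, e v o]] (h.+1 - dO y0) y0D nD0.
  - move=> v vD; apply: connect_trans (_ : connect _ y v); last first.
      by move: vD; rewrite inE => /connect_component.
    by rewrite connect_restrict_sym //; move: (y0D); rewrite inE => /connect_component.
  - move=> x v xD; rewrite in_setD1 => /andP[nvx vD].
    have /card_gt0P[o] : 0 < #|OS :\ p| by have := cardsD1 p OS; rewrite pO; nlia.
    rewrite in_setD1 => /andP[nop oO].
    have oD : o \notin D by apply: contraL oO => /DU; rewrite inE => /andP[].
    have DO u : u \in D -> u \notin OS by move=> /DU; rewrite in_setD => /andP[].
    have DW u : u \in D -> u \in W by move=> /DU; rewrite in_setD => /andP[].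
    have := con [set x; p] v o; rewrite !in_setD !in_set2 (negbTE nvx) (negbTE nop) (DW v vD) (subsetP OSW o oO).
    rewrite (_ : (v == p) = false); last by apply: contraNF (DO v vD) => /eqP->.
    rewrite (_ : (o == x) = false); last by apply: contraNF oD => /eqP->.
    rewrite cards2 => /(_ (leq_b1 _) isT isT) cvo.
    pose D' := [set u | connect (restrict e (D :\ x)) v u].
    have D'D u : u \in D' -> u \in D :\ x by rewrite inE => /connect_restrict_mem; apply; rewrite in_setD1 nvx.
    have oD' : o \notin D' by apply: contra oD => /D'D; rewrite in_setD1 => /andP[].
    have [[]|[u [z [uD' zW euz _]]]] := last_exit cvo oD'; first by rewrite inE connect0.
    exists u; last by move: uD'; rewrite inE.
    have /setD1P[nux uD] := D'D u uD'.
    move: zW; rewrite !in_setD in_set2 => /andP[zD' /andP[/norP[nzx nzp] zW]].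
    rewrite inE; apply/exists_inP; exists z => //; rewrite in_setD1 nzp /=.
    apply: contraNT zD' => zO; rewrite inE; apply: connect_trans (_ : connect _ v u) _.
      by move: uD'; rewrite inE.
    apply: connect1; rewrite restrictE euz !in_setD1 nux nzx uD /=.
    by apply: closedD uD _ euz; rewrite in_setD zO.
  - move=> v; rewrite in_setD1 => /andP[_ vD]; have := degD v vD; have := maxd v vD.
    by rewrite -/(dO v); clear; nlia.
  rewrite inE => /exists_inP[p' p'O elp]; exists pi, p'; split => //.
  by split => //; move: leh; clear; nlia.
move: p'O; rewrite in_setD1 => /andP[np' p'O].
have p's : p' \in s by rewrite inE in p'O.
have [i s' defs] := rot_to p's.
have pms : perm_eq s (p' :: s') by rewrite -defs perm_sym perm_rot.
have ps' : p \in s'.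
  have : p \in s by rewrite inE in pO.
  by rewrite (perm_mem pms) inE eq_sym (negbTE np').
have lt : count (e y0) s' + (size pi).+1 < h.
  apply: (@detour_count W p' s' y0 pi h) => //.
  - by rewrite -defs rot_cycle.
  - by rewrite -defs rot_uniq.
  - by move=> x; rewrite -(perm_mem pms) => /subs.
  - by move=> c cc uc subc; rewrite -[(size s').+1]/(size (p' :: s')) -(perm_size pms); apply: longest.
  - by move=> x /subpi/DU; rewrite in_setD => /andP[].
  - by move=> x /subpi/DU; rewrite in_setD -(perm_mem pms) inE => /andP[].
  by apply/hasP; exists p.
have : dO y0 <= 1 + count (e y0) s'.
  rewrite /dO; have -> : #|[set o in OS | e y0 o]| = count (e y0) s.
    rewrite -size_filter -(card_uniqP _) ?filter_uniq //; apply: eq_card => x.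
    by rewrite !inE mem_filter andbC.
  by rewrite (permP pms) /= leq_add2r leq_b1.
by move: lt leh; clear; nlia.
Qed.

End LongEvenCycle.

(** * Small components and Dirac's theorem *)

Section Components.
Variables (T : finType) (e : rel T).
Hypotheses (e_sym : symmetric e).
Implicit Types S W : {set T}.

Definition component S x : {set T} := [set y | connect (restrict e S) x y].

Lemma component_sub S x : x \in S -> component S x \subset S.
Proof. by move=> xS; apply/subsetP => y; rewrite inE => /connect_restrict_mem; apply. Qed.

Lemma component_closed S x u y : x \in S -> u \in component S x -> y \in S -> e u y ->
  y \in component S x.
Proof.
move=> xS uC yS euy; have uS := subsetP (component_sub xS) u uC.
move: uC; rewrite !inE => cxu; apply: connect_trans cxu _.
by apply: connect1; rewrite restrictE euy uS.
Qed.

Lemma component_in_closed S W x : x \in W ->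
  (forall u y, u \in W -> y \in S -> e u y -> y \in W) ->
  component S x \subset component W x.
Proof.
move=> xW closedW; apply/subsetP => y; rewrite inE => cxy; apply/negPn/negP => yC.
have [[]|[u [z [uC zS euz _]]]] := last_exit cxy yC; first by rewrite inE connect0.
have uW := subsetP (component_sub xW) u uC.
move: zS; rewrite in_setD => /andP[/negP zC zS]; apply: zC.
exact: component_closed xW uC (closedW u z uW zS euz) euz.
Qed.

(** Cutting at most two vertices lowers degrees by at most 2, which is one step of j. Both sides
    still have more than h vertices, so each is smaller than W by at least h + 1. The number of
    deleted vertices satisfies s' <= 2s + 2, whence 2^(j + 1) - 2. *)
Lemma small_components h : 0 < h ->
  (forall W, (forall x, x \in W -> h < #|[set y in W | e x y]|) ->
    (forall S u v, #|S| <= 2 -> u \in W :\: S -> v \in W :\: S ->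
       connect (restrict e (W :\: S)) u v) -> #|W| < 2 * h) ->
  forall j W, #|W| < j.+1 * h.+1 -> (forall x, x \in W -> h + 2 * j < #|[set y in W | e x y]|) ->
  exists S, #|S| + 2 <= 2 ^ j.+1 /\ forall x, x \in W :\: S -> #|component (W :\: S) x| < 2 * h.
Proof.
move=> h0 smallW; elim=> [|j IH] W ltW degW.
  exists set0; rewrite cards0; split => // x; rewrite setD0 => xW.
  have := degW x xW; have : #|[set y in W | e x y]| <= #|W|.
    by apply: subset_leq_card; apply/subsetP => y; rewrite inE => /andP[].
  by move: ltW; nlia.
have [/existsP[S0 /existsP[u /existsP[v /and4P[cS uW vW nuv]]]] | no] :=
  boolP [exists S : {set T}, exists u, exists v,
    [&& #|S| <= 2, u \in W :\: S, v \in W :\: S & ~~ connect (restrict e (W :\: S)) u v]]; last first.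
  exists set0; rewrite cards0; split => [|x]; first by rewrite add0n (@leq_pexp2l 2 1).
  rewrite setD0 => xW; apply: leq_ltn_trans (subset_leq_card (component_sub xW)) _.
  apply: smallW => [y yW|S u v cS uW vW]; first by apply: leq_ltn_trans (degW y yW); apply: leq_addr.
  apply: contraNT no => nc; apply/existsP; exists S; apply/existsP; exists u; apply/existsP; exists v.
  by rewrite cS uW vW.
pose V := W :\: S0; pose W1 := component V u; pose W2 := V :\: W1.
have W1V : W1 \subset V by apply: component_sub.
have c12 : #|W1| + #|W2| <= #|W|.
  by rewrite -(setIidPr W1V) cardsID; apply: subset_leq_card; apply: subsetDl.
have cl1 x y : x \in W1 -> y \in V -> e x y -> y \in W1 by move=> *; apply: component_closed; eauto.
have cl2 x y : x \in W2 -> y \in V -> e x y -> y \in W2.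
  move=> /setDP[xV xW1] yV exy; apply/setDP; split => //; apply: contra xW1 => yW1.
  by apply: cl1 yW1 xV _; rewrite e_sym.
have deg' (W' : {set T}) : W' \subset V -> (forall x y, x \in W' -> y \in V -> e x y -> y \in W') ->
    forall x, x \in W' -> h + 2 * j < #|[set y in W' | e x y]|.
  move=> sW' cl x xW'; have xW : x \in W by have := subsetP sW' x xW'; rewrite in_setD => /andP[].
  have sub : [set y in W | e x y] \subset [set y in W' | e x y] :|: S0.
    apply/subsetP => y; rewrite in_setU !in_set => /andP[yW exy]; rewrite exy andbT.
    have [//|yS] := boolP (y \in S0); first by rewrite orbT.
    by rewrite (cl x y) // in_setD yS.
  have := subset_leq_card sub; have [+ _] := leq_card_setU [set y in W' | e x y] S0.
  by have := degW x xW; nlia.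
have big (W' : {set T}) x : x \in W' -> W' \subset V ->
    (forall x y, x \in W' -> y \in V -> e x y -> y \in W') -> h < #|W'|.
  move=> xW' sW' cl; apply: leq_ltn_trans (_ : h + 2 * j < _); first exact: leq_addr.
  apply: leq_trans (deg' W' sW' cl x xW') _; apply: subset_leq_card.
  by apply/subsetP => y; rewrite inE => /andP[].
have uW1 : u \in W1 by rewrite inE connect0.
have vW2 : v \in W2 by apply/setDP; split => //; rewrite inE.
have W2V : W2 \subset V by apply: subsetDl.
have b1 := big W1 u uW1 W1V cl1; have b2 := big W2 v vW2 W2V cl2.
have [|S1 [cS1 sm1]] := IH W1 _ (deg' W1 W1V cl1); first by rewrite mulSn in ltW; nlia.
have [|S2 [cS2 sm2]] := IH W2 _ (deg' W2 W2V cl2); first by rewrite mulSn in ltW; nlia.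
exists (S0 :|: (S1 :|: S2)); split.
  have [+ _] := leq_card_setU S0 (S1 :|: S2); have [+ _] := leq_card_setU S1 S2.
  by rewrite [2 ^ j.+2]expnS; nlia.
move=> x; rewrite in_setD !in_setU => /andP[/norP[xS0 /norP[xS1 xS2]] xW].
have xV : x \in V by rewrite in_setD xS0.
have piece (W' S' : {set T}) : (forall x y, x \in W' -> y \in V -> e x y -> y \in W') ->
    x \in W' -> x \notin S' -> S' \subset S1 :|: S2 ->
    (forall x, x \in W' :\: S' -> #|component (W' :\: S') x| < 2 * h) ->
    #|component (W :\: (S0 :|: (S1 :|: S2))) x| < 2 * h.
  move=> cl xW' xS' sS' sm; have xWS : x \in W' :\: S' by rewrite in_setD xS'.
  apply: leq_ltn_trans (sm x xWS); apply: subset_leq_card; apply: component_in_closed => // a y.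
  rewrite in_setD => /andP[_ aW']; rewrite in_setD in_setU => /andP[/norP[yS0 yS] yW] eay.
  rewrite in_setD (cl a y) ?in_setD ?yS0 // andbT; apply: contra yS; exact: subsetP.
have [xW1|xW1] := boolP (x \in W1); first by apply: (piece W1 S1) => //; apply: subsetUl.
by apply: (piece W2 S2) => //; [rewrite in_setD xW1 | apply: subsetUr].
Qed.

End Components.

Section Dirac.
Variables (T : finType) (e : rel T).
Hypotheses (e_sym : symmetric e) (e_irr : irreflexive e).

Fixpoint gaps (x : T) (s : seq T) : nat := if s is y :: s' then ~~ e x y + gaps y s' else 0.

Lemma gaps_cat x s t : gaps x (s ++ t) = gaps x s + gaps (last x s) t.
Proof. by elim: s x => //= y s IH x; rewrite IH addnA. Qed.

Lemma gaps_rev x s : gaps (last x s) (rev (belast x s)) = gaps x s.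
Proof.
elim: s x => //= y s IH x; rewrite rev_cons -cats1 gaps_cat IH /= addn0 addnC.
congr (~~ _ + _); case: s {IH} => [|z s] /=; first by rewrite e_sym.
by rewrite rev_cons last_rcons e_sym.
Qed.

Lemma gaps0 x s : gaps x s = 0 -> path e x s.
Proof. by elim: s x => //= y s IH x /eqP; rewrite addn_eq0 eqb0 negbK => /andP[-> /eqP/IH]. Qed.

(* Palmer's argument: reversing a segment closes one gap without opening another. *)
Lemma dirac (X : {set T}) n : 1 < n -> #|X| = 2 * n ->
  (forall x, x \in X -> n <= #|[set y in X | e x y]|) -> has_cycle e X (2 * n).
Proof.
move=> n1 cX deg.
pose spans b s := uniq (b :: s) /\ (b :: s) =i X.
(* To join the last vertex x to b, a position i is sought with x adjacent to entry i and b adjacent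
   to entry i + 1; reversing everything after i then ends next to b and opens no new gap. Each
   condition holds for at least n of the 2n - 1 positions, so some i meets both. *)
have close b s : spans b s -> exists b' s', [/\ spans b' s', e (last b' s') b' & gaps b' s' <= gaps b s].
  move=> [us sX]; have [ok|gap] := boolP (e (last b s) b); first by exists b, s.
  have szs : (size s).+1 = 2 * n by rewrite -cX -(eq_card sX) (card_uniqP us).
  set x := last b s; pose f i := nth b (b :: s) i.
  have cnt y (g : nat -> nat) : y \in X -> (forall z, z \in X -> e y z -> exists2 i, i < size s & z = f (g i)) ->
      n <= #|[set i : 'I_(size s) | e y (f (g i))]|.
    pose A := [set i : 'I_(size s) | e y (f (g i))].
    have le2 := leq_imset_card (fun i : 'I_(size s) => f (g i)) A.
    move=> yX gz; apply: leq_trans (deg y yX) (leq_trans _ le2).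
    apply: subset_leq_card; apply/subsetP => z; rewrite inE => /andP[zX eyz].
    have [i lti def] := gz z zX eyz; apply/imsetP; exists (Ordinal lti) => //.
    by rewrite inE /= -def.
  have xX : x \in X by rewrite -sX mem_last.
  have bX : b \in X by rewrite -sX mem_head.
  have fx : f (size s) = x by rewrite /f /x -[size s]/((size (b :: s)).-1) nth_last.
  have c1 := @cnt x id xX _; have c2 := @cnt b succn bX _.
  have /card_gt0P[i] : 0 < #|[set i : 'I_(size s) | e x (f i)] :&: [set i : 'I_(size s) | e b (f i.+1)]|.
    have := cardsUI [set i : 'I_(size s) | e x (f i)] [set i : 'I_(size s) | e b (f i.+1)].
    have : #|[set i : 'I_(size s) | e x (f i)] :|: [set i : 'I_(size s) | e b (f i.+1)]| <= size s.
      by rewrite -[X in _ <= X]card_ord max_card.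
    have {}c1 := c1 _; have {}c2 := c2 _.
    have h1 : n <= #|[set i : 'I_(size s) | e x (f i)]|.
      apply: c1 => z; rewrite -sX => zs exz; exists (index z (b :: s)); last by rewrite /f nth_index.
      have : index z (b :: s) < size (b :: s) by rewrite index_mem.
      rewrite [size (_ :: _)]/= ltnS leq_eqVlt => /orP[/eqP ez|//].
      by move: exz; rewrite -[z](nth_index b zs) ez -/(f _) fx e_irr.
    have h2 : n <= #|[set i : 'I_(size s) | e b (f i.+1)]|.
      apply: c2 => z; rewrite -sX => zs ebz; exists (index z s).
        rewrite index_mem; move: zs; rewrite inE => /predU1P[eb|//].
        by rewrite eb e_irr in ebz.
      rewrite /f /= nth_index //; move: zs; rewrite inE => /predU1P[eb|//].
      by rewrite eb e_irr in ebz.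
    by move: szs h1 h2; clear; nlia.
  rewrite !inE => /andP[]; move: (ltn_ord i); move: (nat_of_ord i) => {}i lti exi ebi.
  have ds : drop i s = f i.+1 :: drop i.+1 s by rewrite (drop_nth b).
  have ls : last (f i.+1) (drop i.+1 s) = x.
    have : last b s = last b (drop i s) by rewrite -{1}(cat_take_drop i s) last_cat ds.
    by rewrite ds /= => <-.
  have lt : last b (take i s) = f i.
    exact: last_take (ltnW lti).
  exists b, (take i s ++ rev (drop i s)).
  have pm : perm_eq (b :: take i s ++ rev (drop i s)) (b :: s).
    by rewrite perm_cons -{3}(cat_take_drop i s) perm_cat2l perm_rev.
  have lr y t : last y (rev (f i.+1 :: t)) = f i.+1 by rewrite rev_cons last_rcons.
  split.
  - by split; [rewrite (perm_uniq pm) | move=> z; rewrite (perm_mem pm)].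
  - by rewrite last_cat ds lr e_sym.
  rewrite -[X in _ <= gaps b X](cat_take_drop i) !gaps_cat leq_add2l lt ds.
  have -> : rev (f i.+1 :: drop i.+1 s) = x :: rev (belast (f i.+1) (drop i.+1 s)).
    by rewrite lastI rev_rcons ls.
  have := gaps_rev (f i.+1) (drop i.+1 s); rewrite ls => gr.
  by rewrite /= gr [e _ x]e_sym exi add0n leq_addl.
have main k b s : gaps b s <= k -> spans b s -> e (last b s) b -> has_cycle e X (2 * n).
  elim: k b s => [|k IH] b s.
    rewrite leqn0 => /eqP/gaps0 ps [us sX] elb; exists (b :: s); split => //.
    - by rewrite /= rcons_path ps elb.
    - by rewrite -cX -(eq_card sX) (card_uniqP us).
    by move=> x; rewrite sX.
  move=> gk [us sX] elb; have [/gaps0 ps|gp] := eqVneq (gaps b s) 0.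
    exists (b :: s); split => //.
    - by rewrite /= rcons_path ps elb.
    - by rewrite -cX -(eq_card sX) (card_uniqP us).
    by move=> x; rewrite sX.
  (* Rotating the order puts this gap at the closing place, where [close] repairs it; the former
     closing edge moves inside and adds no gap. *)
  have [p [c [q [def gap]]]] : exists p c q, s = p ++ c :: q /\ ~~ e (last b p) c.
    elim: (s) (b) gp => //= c s' IHs b'; have [e1|e1] := boolP (e b' c); last by exists [::], c, s'.
    by move=> /IHs[p [d [q [-> h]]]]; exists (c :: p), d, q.
  have pm : perm_eq (c :: q ++ b :: p) (b :: s).
    by rewrite def -cat_cons perm_catC.
  have sp : spans c (q ++ b :: p) by split; [rewrite (perm_uniq pm) | move=> z; rewrite (perm_mem pm) sX].
  have [b' [s' [sp' el' g']]] := close c (q ++ b :: p) sp.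
  apply: (IH b' s') => //; apply: leq_trans g' _.
  move: gk; rewrite def gaps_cat /= gap gaps_cat /=.
  by move: elb; rewrite def last_cat /= => -> /=; clear; nlia.
case def : (enum X) => [|b s]; first by move: cX; rewrite cardE def /=; nlia.
have sp : spans b s by rewrite /spans -def enum_uniq; split => // z; rewrite mem_enum.
have [b' [s' [sp' el' _]]] := close b s sp.
exact: main (leqnn _) sp' el'.
Qed.

End Dirac.

(** * Cycle against wheel *)

(** The wheel is sought as a colour-2 cycle in the neighbourhood of v. A vertex of colour-2 degree
    at least 2n + m + [CA] is settled by [cycle_ramsey]; otherwise colour-1 degrees are large enough
    to split the graph into small pieces. *)
Lemma cycle_or_wheel : exists C m0 : nat, forall n m (T : finType) (R B : rel T),
  symmetric R -> symmetric B -> irreflexive R -> irreflexive B ->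
  (forall x y, x != y -> R x y || B x y) ->
  m0 <= m -> n <= 2 * m -> m < n -> #|T| = 2 * n + 2 * m + C ->
  has_cycle R setT (2 * m) \/ exists v, has_cycle B [set y | B v y] (2 * n).
Proof.
have [CA HA] := cycle_ramsey; have [K [mG HG]] := even_cycle_lengths.
(* After subtracting [CA], the part 4K covers the excess over 2m of two pieces with fewer than 2(m +
   K) vertices each, and 200 covers the at most 126 deleted vertices and the degree loss of 12. *)
pose C := CA + 4 * K + 200; exists C, (C + mG) => n m T R B R_sym B_sym R_irr B_irr RB lem len ltmn cT.
have [|noR] := has_cycleP R setT (2 * m); [by left | right].
have [/existsP[v lev]|small] := boolP [exists v, 2 * n + m + CA <= #|[set y | B v y]|].
  exists v; have [|||hR|//] := HA m n T R B [set y | B v y] R_sym B_sym RB.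
  - by rewrite /C in lem; nlia.
  - exact: ltnW.
  - by [].
  by case: noR; apply: has_cycleS hR; apply: subsetT.
have deg x : m + K + 12 < #|[set y in setT | R x y]|.
  have : [set: T] \subset [set y in setT | R x y] :|: ([set y | B x y] :|: [set x]).
    apply/subsetP => y _; rewrite !inE /=; have [->|nyx] := eqVneq y x; first by rewrite !orbT.
    by rewrite eq_sym in nyx; move: (RB x y nyx); rewrite orbF.
  move/subset_leq_card; rewrite cardsT cT.
  have [+ _] := leq_card_setU [set y in setT | R x y] ([set y | B x y] :|: [set x]).
  have [+ _] := leq_card_setU [set y | B x y] [set x]; rewrite cards1.
  have : #|[set y | B x y]| < 2 * n + m + CA.
    by rewrite ltnNge; apply: contra small => le; apply/existsP; exists x.
  rewrite /C; nlia.
pose h := m + K; have h0 : 0 < h by rewrite /h /C in lem *; nlia.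
have smallW (W : {set T}) : (forall x, x \in W -> h < #|[set y in W | R x y]|) ->
    (forall (S : {set T}) u v, #|S| <= 2 -> u \in W :\: S -> v \in W :\: S ->
       connect (restrict R (W :\: S)) u v) -> #|W| < 2 * h.
  move=> degW conW; rewrite ltnNge; apply/negP => leW.
  have [k ek [lek [s [cs us ss subs]]]] := long_even_cycle R_sym R_irr h0 leW degW conW.
  case: noR; apply: (HG T R m [set: T] s) => //.
  - by apply: leq_trans lem; apply: leq_addl.
  - by rewrite cardsT cT; rewrite /C in lem *; nlia.
  - by move=> x _; apply: leq_trans (ltnW (deg x)); rewrite -addnA leq_addr.
  - by move=> x _; rewrite inE.
  - by rewrite ss.
  by rewrite ss; apply: leq_trans lek; rewrite /h; nlia.
(* Since n <= 2m and C <= m, there are at most 6m + C < 7(h + 1) vertices; hence j = 6, which costs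
   degree 12 and at most 2^7 - 2 vertices. *)
have [||S [cS smS]] := small_components R_sym h0 smallW (j := 6) (W := [set: T]).
- by rewrite cardsT cT /h; rewrite /C in lem *; nlia.
- by move=> x _; apply: leq_trans (deg x); rewrite /h.
have {}cS : #|S| <= 126 by move: cS; rewrite -[2 ^ 7]/128; clear; nlia.
pose U := [set: T] :\: S; rewrite -/U in smS.
have cU : #|T| <= #|U| + 126.
  by rewrite -cardsT -(cardsID S [set: T]) addnC leq_add2l setTI.
pose comp := component R U.
have comp_sub x : x \in U -> comp x \subset U by apply: component_sub.
have comp_refl x : x \in comp x by rewrite inE connect0.
have comp_sym x y : (y \in comp x) = (x \in comp y) by rewrite !inE connect_restrict_sym.
have comp_trans x y z : y \in comp x -> z \in comp y -> z \in comp x.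
  by rewrite !inE; apply: connect_trans.
have compB x y : x \in U -> y \in U -> y \notin comp x -> B x y.
  move=> xU yU yC; have nxy : x != y by apply: contraNneq yC => <-.
  have := RB x y nxy; case Rxy : (R x y) => //= _.
  by case/negP: yC; apply: component_closed xU (comp_refl x) yU Rxy.
have /card_gt0P[w0 w0U] : 0 < #|U| by rewrite cT /C in cU; nlia.
have [w wU' maxw] := arg_maxnP (fun x => #|comp x|) w0U; have wU : w \in U by [].
have smw := smS w wU; rewrite -/(comp w) in smw.
pose U1 := U :\: comp w.
have cU1 : #|U| = #|U1| + #|comp w|.
  by rewrite -(cardsID (comp w) U) addnC (setIidPr (comp_sub w wU)).
have /card_gt0P[v0 v0U] : 0 < #|U1| by rewrite cT /C /h in cU smw; nlia.
have [v vU1' minv] := arg_minnP (fun x => #|comp x|) v0U; have /setDP[vU vw] : v \in U1 by [].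
have dvw x : x \in comp v -> x \notin comp w.
  by move=> xv; apply: contra vw => xw; apply: comp_trans xw _; rewrite comp_sym.
pose D := U1 :\: comp v.
have sv1 : comp v \subset U1.
  by apply/subsetP => x xv; apply/setDP; split; [apply: (subsetP (comp_sub v vU)) | apply: dvw].
have cD : #|U1| = #|D| + #|comp v|.
  by rewrite -(cardsID (comp v) U1) addnC (setIidPr sv1).
have smv := smS v vU; rewrite -/(comp v) in smv.
have compD z : z \in D -> comp z \subset D.
  move=> /setDP[/setDP[zU zw] zv]; apply/subsetP => x xz.
  have xU := subsetP (comp_sub z zU) x xz.
  apply/setDP; split; last by apply: contra zv => xv; apply: comp_trans xv _; rewrite comp_sym.
  by apply/setDP; split => //; apply: contra zw => xw; apply: comp_trans xw _; rewrite comp_sym.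
(* D contains a whole component, which is at least as large as that of v, so D is at least half of
   [U1]; and [U1] has at least 2n vertices. *)
have leD : n <= #|D|.
  have /card_gt0P[z zD] : 0 < #|D| by rewrite cT /C /h in cU smw smv; nlia.
  have /setDP[zU1 _] := zD; have := minv z zU1; have := subset_leq_card (compD z zD).
  by rewrite cT /C /h in cU smw; nlia.
(* Dirac's condition on X says that no component fills more than half of it. If the largest
   component has at least n vertices, n are taken from it and n from D; otherwise every component is
   below n, and any 2n vertices off the component of v will do. *)
have [X [cX sXU Xv Xcomp]] : exists X : {set T}, [/\ #|X| = 2 * n, X \subset U,
    forall x, x \in X -> x \notin comp v & forall x, x \in X -> #|X :&: comp x| <= n].
  have DU x : x \in D -> [/\ x \in U, x \notin comp w & x \notin comp v].
    by move=> /setDP[/setDP[]].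
  have [lew|ltw] := leqP n #|comp w|.
    have [xs [uxs sxs subxs]] := take_enum lew; have [ys [uys sys subys]] := take_enum leD.
    have inX x : (x \in [set x in xs] :|: [set x in ys]) = (x \in xs) || (x \in ys) by rewrite !inE.
    exists ([set x in xs] :|: [set x in ys]); split.
    + rewrite cardsU (_ : _ :&: _ = set0) ?cards0 ?subn0.
        by rewrite !cardsE (card_uniqP uxs) (card_uniqP uys) sxs sys mul2n addnn.
      apply/eqP; rewrite -subset0; apply/subsetP => x; rewrite !in_set => /andP[/subxs xw /subys/DU[_ nxw _]].
      by rewrite xw in nxw.
    + apply/subsetP => x; rewrite inX => /orP[/subxs|/subys/DU[]//].
      exact: (subsetP (comp_sub w wU)).
    + move=> x; rewrite inX => /orP[/subxs xw|/subys/DU[]//].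
      by apply: contraL xw; apply: dvw.
    move=> x; rewrite inX => /orP[/subxs xw|/subys xD].
      rewrite -sxs -(card_uniqP uxs); apply: subset_leq_card; apply/subsetP => y.
      rewrite in_setI inX => /andP[/orP[//|/subys/DU[_ nyw _]] yx].
      by case/negP: nyw; apply: comp_trans yx.
    rewrite -sys -(card_uniqP uys); apply: subset_leq_card; apply/subsetP => y.
    rewrite in_setI inX => /andP[/orP[/subxs yw|//] yx].
    by have /DU[_ /negP[]] := subsetP (compD x xD) y yx.
  have [|xs [uxs sxs subxs]] := @take_enum _ (U :\: comp v) (2 * n).
    have := cardsID (comp v) U; have := subset_leq_card (subsetIr U (comp v)).
    by rewrite cT /C /h in cU smv; nlia.
  exists [set x in xs]; split.
  + by rewrite cardsE (card_uniqP uxs).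
  + by apply/subsetP => x; rewrite inE => /subxs/setDP[].
  + by move=> x; rewrite inE => /subxs/setDP[].
  move=> x; rewrite inE => /subxs/setDP[xU _]; apply: leq_trans (ltnW ltw).
  by apply: leq_trans (maxw x xU); apply: subset_leq_card; apply: subsetIr.
have XU := subsetP sXU.
exists v; apply: (@has_cycleS _ _ X).
  by apply/subsetP => x xX; rewrite inE; apply: compB; [| apply: XU | apply: Xv].
apply: dirac => //; first by rewrite /C in lem; nlia.
move=> x xX; have := cardsID (comp x) X; have := Xcomp x xX; rewrite cX => c1 c2.
apply: leq_trans (_ : n <= #|X :\: comp x|) _; first by nlia.
apply: subset_leq_card; apply/subsetP => y /setDP[yX yx]; rewrite inE yX.
by apply: compB; rewrite ?XU.
Qed.

(** * Embeddings and the lower bound *)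

Lemma containsP (G H : sgraph) :
  reflect (exists2 f : H -> G, injective f & forall x y, edge x y -> edge (f x) (f y))
    (contains G H).
Proof.
apply: (iffP existsP) => [[f /andP[/injectiveP fi /forallP fe]] | [f fi fe]].
  by exists f => // x y exy; have /forallP/(_ y)/implyP := fe x; apply.
exists [ffun x => f x]; apply/andP; split.
  by apply/injectiveP => x y; rewrite !ffunE => /fi.
by apply/forallP => x; apply/forallP => y; apply/implyP => /fe; rewrite !ffunE.
Qed.

Lemma contains_trans (G H K : sgraph) : contains G H -> contains H K -> contains G K.
Proof.
move=> /containsP[f fi fe] /containsP[g gi ge]; apply/containsP.
by exists (f \o g) => [|x y /ge/fe]; first exact: inj_comp.
Qed.

Lemma has_cycle_embedding (T : finType) (e : rel T) (X : {set T}) l :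
  symmetric e -> 0 < l -> has_cycle e X l ->
  exists f : 'I_l -> T, [/\ injective f, forall i, f i \in X &
    forall i j, cycle_edge i j -> e (f i) (f j)].
Proof.
move=> e_sym l0 [s [cs us ss subs]]; subst l.
have [x0 _] : exists x0 : T, x0 \in s by case: (s) l0 => // x t _; exists x; rewrite mem_head.
exists (fun i : 'I_(size s) => nth x0 s i); split.
- by move=> i j /eqP; rewrite nth_uniq // => /eqP/val_inj.
- by move=> i; apply/subs/mem_nth.
have step (i j : 'I_(size s)) : i.+1 == j %[mod size s] -> e (nth x0 s i) (nth x0 s j).
  by move=> /eqP ij; have := cycle_nth x0 i cs l0; rewrite ij !modn_small.
by move=> i j /andP[_ /orP[/step|/step]] //; rewrite e_sym.
Qed.

Lemma contains_cycle (G : sgraph) (X : {set G}) l :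
  0 < l -> has_cycle (@edge G) X l -> contains G (cycle_graph l).
Proof.
move=> l0 /(has_cycle_embedding (@edge_sym G) l0)[f [fi _ fe]].
by apply/containsP; exists f.
Qed.

Lemma contains_wheel (G : sgraph) (v : G) l :
  0 < l -> has_cycle (@edge G) [set y | edge v y] l -> contains G (wheel_graph l).
Proof.
move=> l0 /(has_cycle_embedding (@edge_sym G) l0)[f [fi fN fe]].
have fv i : edge v (f i) by have := fN i; rewrite inE.
apply/containsP; exists (fun o : wheel_graph l => if o is Some i then f i else v).
  have nv i : f i <> v by move=> fiv; have := fv i; rewrite fiv edge_irrefl.
  by move=> [i|] [j|] //= => [/fi->|/nv|/esym/nv].
by move=> [i|] [j|] //=; [apply: fe | rewrite edge_sym].
Qed.

(** The i-th matching edge is the rim edge between 2i and 2i + 1. *)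
Lemma wheel_contains_fan n : 1 < n -> contains (wheel_graph (2 * n)) (fan_graph n).
Proof.
move=> n1; apply/containsP.
have lt (u : 'I_n * bool) : 2 * u.1 + u.2 < 2 * n by have := ltn_ord u.1; case: (u.2) => /=; nlia.
exists (fun o : fan_graph n => if o is Some u then Some (Ordinal (lt u)) else None : wheel_graph (2 * n)).
  move=> [[i b]|] [[j c]|] //= [h].
  have {}h : 2 * i + b = 2 * j + c by exact: h.
  have ebc : b = c by case: (b) (c) h => [] [] //= h; exfalso; nlia.
  have eij : i = j :> nat by move: h; rewrite ebc => /addIn/eqP; rewrite eqn_mul2l => /eqP.
  by rewrite ebc (ord_inj eij).
have step (i : 'I_n) : cycle_edge (Ordinal (lt (i, false))) (Ordinal (lt (i, true))).
  by rewrite /cycle_edge -val_eqE /= addn0 addn1 eqxx /= andbT neq_ltn ltnSn.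
move=> [[i b]|] [[j c]|] //= /andP[/= /eqP <-]; case: b c => [] [] //= _; first by rewrite cycle_edge_sym step.
exact: step.
Qed.

Lemma ramsey_min (H1 H2 : sgraph) N : ramsey_arrow H1 H2 N -> ramsey H1 H2 <= N.
Proof. by rewrite /ramsey; case: ex_minnP => k _ h /h. Qed.

Lemma ramsey_arrowP (H1 H2 : sgraph) : ramsey_arrow H1 H2 (ramsey H1 H2).
Proof. by rewrite /ramsey; case: ex_minnP. Qed.

Lemma ramsey_monotone (H1 H2 H3 : sgraph) :
  contains H2 H3 -> ramsey H1 H3 <= ramsey H1 H2.
Proof.
move=> c23; apply: ramsey_min; apply/forallP => c.
have /forallP/(_ c)/orP[-> //|c2] := ramsey_arrowP H1 H2.
by rewrite (contains_trans c2 c23) orbT.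
Qed.

(* Colour 1 is a disjoint union of cliques of sizes 2m-1, n-1 and at most n-1. *)
Lemma ramsey_cycle_fan_lower n m : 0 < n -> 1 < m -> n <= 2 * m ->
  2 * n + 2 * m - 2 <= ramsey (cycle_graph (2 * m)) (fan_graph n).
Proof.
move=> n0 m1 len; rewrite leqNgt; apply/negP => ltN.
have := ramsey_arrowP (cycle_graph (2 * m)) (fan_graph n).
move: (ramsey _ _) ltN => N ltN /forallP arrow.
pose part (i : 'I_N) := if i < 2 * m - 1 then 0 else if i < 2 * m + n - 2 then 1 else 2.
pose c : coloring N := [ffun S : {set 'I_N} =>
  [forall x in S, forall y in S, part x == part y]].
have cE x y : c [set x; y] = (part x == part y).
  rewrite ffunE; apply/forall_inP/idP => [h|pxy u].
    by have /forall_inP := h x (set21 _ _); apply; rewrite set22.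
  rewrite !inE => /orP[]/eqP->; apply/forall_inP => v; rewrite !inE => /orP[]/eqP->//.
  by rewrite eq_sym.
have part_le2 x : part x <= 2 by rewrite /part; case: ifP => // _; case: ifP.
have cpart k : #|[set x | part x == k]| <= (if k is 0 then 2 * m - 1 else n - 1).
  pose lo := if k is 0 then 0 else if k is 1 then 2 * m - 1 else 2 * m + n - 2.
  pose b := if k is 0 then 2 * m - 1 else n - 1.
  have inj : forall x, x \in [set x | part x == k] -> lo <= x < lo + b.
    move=> x; rewrite inE /lo /b => /eqP <-; rewrite /part; have := ltn_ord x.
    case: ifP => h1; [move: h1 | case: ifP => h2; move: h1 h2]; move: ltN n0 m1; nlia.
  rewrite cardE; have : uniq (map val (enum [set x | part x == k])).
    by rewrite map_inj_uniq ?enum_uniq //; apply: val_inj.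
  move=> u; rewrite -(size_map val) -[X in _ <= X](size_iota lo b); apply: uniq_leq_size u _.
  by move=> y /mapP[x]; rewrite mem_enum => /inj h ->; rewrite mem_iota.
have fit (I : finType) (g : I -> 'I_N) k : injective g -> (forall i, part (g i) = k) ->
    #|I| <= (if k is 0 then 2 * m - 1 else n - 1).
  move=> gi gk; apply: leq_trans (cpart k); rewrite -(card_imset _ gi).
  by apply: subset_leq_card; apply/subsetP => _ /imsetP[i _ ->]; rewrite inE gk.
have [/containsP[f fi fe]|/containsP[f fi fe]] := orP (arrow c).
  have fE (i j : 'I_(2 * m)) : i.+1 = j -> part (f i) = part (f j).
    move=> ij; have : cycle_edge i j.
      by rewrite /cycle_edge ij eqxx andbT -val_eqE /= neq_ltn -ij ltnSn.
    by move/fe => /andP[_]; rewrite cE eqb_id => /eqP.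
  have l0 : 0 < 2 * m by nlia.
  have fp i (lti : i < 2 * m) : part (f (Ordinal lti)) = part (f (Ordinal l0)).
    elim: i lti => [|i IH] lti; first by congr (part (f _)); apply: val_inj.
    by rewrite -(IH (ltnW lti)); apply/esym/fE.
  have fp' (i : 'I_(2 * m)) : part (f i) = part (f (Ordinal l0)).
    by rewrite -(fp i (ltn_ord i)); congr (part (f _)); apply: val_inj.
  have := fit _ f _ fi fp'; rewrite card_ord; case: (part _) => [|_]; move: n0 m1 len; nlia.
pose v := f None.
have fv u : part v != part (f (Some u)).
  by have /andP[_] := fe None (Some u) isT; rewrite cE => /eqP ->.
have fu (i : 'I_n) : part (f (Some (i, false))) != part (f (Some (i, true))).
  have : edge (Some (i, false) : fan_graph n) (Some (i, true)) by rewrite /= /matching_edge /= eqxx.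
  by move/fe => /andP[_]; rewrite cE => /eqP ->.
(* Part [k] is one of the two small parts and does not contain the centre. Each matching edge joins
   the two parts that avoid the centre, so it has an end in part [k]; these n ends do not fit. *)
pose k := if part v == 1 then 2 else 1.
pose g i := if part (f (Some (i, false))) == k then f (Some (i, false)) else f (Some (i, true)).
have gi : injective g.
  by move=> i j; rewrite /g; case: ifP => _; case: ifP => _ /fi[].
have gk i : part (g i) = k.
  rewrite /g; case: ifP => [/eqP //|].
  have := fu i; have := fv (i, false); have := fv (i, true).
  have := part_le2 v; have := part_le2 (f (Some (i, false))); have := part_le2 (f (Some (i, true))).
  rewrite /k; case: (part v) => [|[|[|pv]]] //; case: (part (f (Some (i, false)))) => [|[|[|p1]]] //;
  by case: (part (f (Some (i, true)))) => [|[|[|p2]]].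
have := fit _ g k gi gk; rewrite card_ord /k; case: ifP => _; move: n0; nlia.
Qed.

Theorem theorem1p6 :
  exists C m0 : nat, forall n m : nat,
    m0 <= n -> m0 <= m -> n <= 2 * m -> m < n ->
    [/\ 2 * n + 2 * m - 2 <= ramsey (cycle_graph (2 * m)) (fan_graph n),
        ramsey (cycle_graph (2 * m)) (fan_graph n)
          <= ramsey (cycle_graph (2 * m)) (wheel_graph (2 * n))
      & ramsey (cycle_graph (2 * m)) (wheel_graph (2 * n))
          <= 2 * n + 2 * m + C].
Proof.
have [C [m0 H]] := cycle_or_wheel; exists C, (m0 + 2) => n m _ lem len ltmn.
have m1 : 1 < m by nlia.
split; first by apply: ramsey_cycle_fan_lower => //; nlia.
  by apply/ramsey_monotone/wheel_contains_fan; nlia.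
apply: ramsey_min; apply/forallP => c; apply/orP.
pose G i := color_class c i.
have [|||cyc|[v whl]] := H n m _ (@edge (G true)) (@edge (G false)) (@edge_sym (G true))
  (@edge_sym (G false)) (@edge_irrefl (G true)) (@edge_irrefl (G false)) _ _ len ltmn _.
- by move=> x y nxy; rewrite /= /color_edge nxy /=; case: (c _).
- by nlia.
- by rewrite card_ord.
- by left; apply: (@contains_cycle (G true) setT) => //; nlia.
by right; apply: (@contains_wheel (G false) v) => //; nlia.
Qed.
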